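(* Let $\{\Phi_t\}_{t\ge 0}$ be a primitive quantum Markov semigroup on $M_n(\mathbb{C})$ with generator $\mathcal{L}$ that is KMS-symmetric with respect to its faithful invariant state $\rho$. For every $0<\varepsilon<\tfrac12$, $$\frac{\sqrt{s_+s_-}}{s_-+s_+}\,\frac{1}{h_\rho(\mathcal{L})}\log\frac{1}{2\varepsilon}\;\le\; t_{\mathrm{mix}}(\varepsilon)\;\le\;\frac{2s_+^2\,\|\mathcal{L}\|_{\mathrm{KMS},\rho}}{s_-^2\,h_\rho(\mathcal{L})^2}\,\log\frac{\sqrt{s_-^{-1}-1}}{2\varepsilon}.$$
   Context: Throughout $n\ge 2$ and $M_n(\mathbb{C})$ carries the unnormalized trace $\mathrm{Tr}$. A quantum Markov semigroup is a norm-continuous semigroup $\{\Phi_t\}_{t\ge0}$ of unital completely positive linear maps on $M_n(\mathbb{C})$ with $\Phi_0=\mathrm{Id}$; its generator $\mathcal{L}$ is defined by $\Phi_t=e^{-t\mathcal{L}}$. A faithful state $\rho$ has positive definite density matrix $D_\rho$, $\rho(X)=\mathrm{Tr}(D_\rho X)$; $s_-$ and $s_+$ are the smallest and largest eigenvalues of $D_\rho$. The KMS inner product is $\langle X,Y\rangle_{\mathrm{KMS},\rho}=\mathrm{Tr}(X^*D_\rho^{1/2}YD_\rho^{1/2})$, with norm $\|X\|_{\mathrm{KMS},\rho}$; for a linear map, $\|\mathcal{L}\|_{\mathrm{KMS},\rho}=\sup_{X\ne0}\|\mathcal{L}(X)\|_{\mathrm{KMS},\rho}/\|X\|_{\mathrm{KMS},\rho}$.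 The semigroup is KMS-symmetric with respect to $\rho$ if $\langle X,\Phi_t(Y)\rangle_{\mathrm{KMS},\rho}=\langle \Phi_t(X),Y\rangle_{\mathrm{KMS},\rho}$ for all $t\ge0$ and all $X,Y$. It is primitive if it admits a faithful invariant state and $\ker\mathcal{L}=\mathbb{C}I$; $\rho$ is then the unique invariant state. Projection Dirichlet conductance: $h_\rho(\mathcal{L})=\inf_{P}\dfrac{\langle P,\mathcal{L}(P)\rangle_{\mathrm{KMS},\rho}}{\min\{\rho(P),1-\rho(P)\}}$, the infimum over all orthogonal projections $P\in M_n(\mathbb{C})$ with $P\ne0,I$. Mixing time: for $0<\varepsilon<1$, $t_{\mathrm{mix}}(\varepsilon)=\inf\{t\ge0:\ \sup_{D}\|\Phi_t^*(D)-D_\rho\|_1\le2\varepsilon\}$, the supremum over all density matrices $D\in M_n(\mathbb{C})$ (positive semidefinite, trace one), where $\Phi_t^*$ is the adjoint of $\Phi_t$ with respect to $\mathrm{Tr}$, i.e. $\mathrm{Tr}(\Phi_t^*(D)X)=\mathrm{Tr}(D\Phi_t(X))$, and $\|X\|_1=\mathrm{Tr}(|X|)$. *)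

(* Defs.v *)
From HB Require Import structures.
From mathcomp Require Import all_boot all_order all_algebra.
From mathcomp Require Import spectral complex.
From mathcomp Require Import all_classical all_reals all_analysis.
Import Order.TTheory GRing.Theory Num.Theory.
Import numFieldNormedType.Exports.

Set Implicit Arguments.
Unset Strict Implicit.
Unset Printing Implicit Defensive.

Local Open Scope classical_set_scope.
Local Open Scope ring_scope.
Local Open Scope complex_scope.
Local Open Scope sesquilinear_scope.

Section Matrices.
Context {R : realType}.
Implicit Types m n : nat.

(* The order of R[i] makes [0 <= z] say that z is real and nonnegative; over
   the complex numbers both predicates therefore imply that A is Hermitian. *)
Definition psdmx {m} (A : 'M[R[i]]_m) : Prop :=
  forall v : 'cV[R[i]]_m, 0 <= (v^t* *m A *m v) 0 0.

Definition pdmx {m} (A : 'M[R[i]]_m) : Prop :=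
  forall v : 'cV[R[i]]_m, v != 0 -> 0 < (v^t* *m A *m v) 0 0.

(* Spectral calculus; the positive square root of A when A is positive
   semidefinite (see [mxsqrtK] and [mxsqrt_psd]). *)
Definition mxsqrt {n} (A : 'M[R[i]]_n) : 'M[R[i]]_n :=
  invmx (spectralmx A) *m diag_mx (map_mx sqrtC (spectral_diag A))
    *m spectralmx A.

Definition mxabs {n} (A : 'M[R[i]]_n) : 'M[R[i]]_n := mxsqrt (A^t* *m A).

Definition trnorm {n} (A : 'M[R[i]]_n) : R := complex.Re (\tr (mxabs A)).

Definition is_min_eigenvalue {n} (A : 'M[R[i]]_n) (s : R) : Prop :=
  eigenvalue A s%:C /\ forall a : R[i], eigenvalue A a -> s%:C <= a.

Definition is_max_eigenvalue {n} (A : 'M[R[i]]_n) (s : R) : Prop :=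
  eigenvalue A s%:C /\ forall a : R[i], eigenvalue A a -> a <= s%:C.

Definition vnorm {n} (v : 'cV[R[i]]_n) : R :=
  Num.sqrt (complex.Re ((v^t* *m v) 0 0)).

Definition opnorm {n} (A : 'M[R[i]]_n) : R :=
  sup [set vnorm (A *m v) / vnorm v | v in [set v : 'cV[R[i]]_n | v != 0]].

Definition map_norm {n} (N : 'M[R[i]]_n -> R) (F : 'M[R[i]]_n -> 'M[R[i]]_n) : R :=
  sup [set N (F X) / N X | X in [set X : 'M[R[i]]_n | X != 0]].

Definition orthogonal_projection {n} (P : 'M[R[i]]_n) : Prop :=
  P^t* = P /\ P *m P = P.

End Matrices.

Section States.
Context {R : realType} {n : nat}.
Implicit Types (D X Y : 'M[R[i]]_n).

Definition density_matrix D : Prop := psdmx D /\ \tr D = 1.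

Definition faithful_density D : Prop := pdmx D /\ \tr D = 1.

Definition state D X : R[i] := \tr (D *m X).

Definition kms D X Y : R[i] := \tr (X^t* *m mxsqrt D *m Y *m mxsqrt D).

Definition kms_norm D X : R := Num.sqrt (complex.Re (kms D X X)).

End States.

Section Semigroups.
Context {R : realType} {n : nat}.
Implicit Types (D : 'M[R[i]]_n).
Implicit Types (F L : {linear 'M[R[i]]_n -> 'M[R[i]]_n}).
Implicit Types (Phi : R -> {linear 'M[R[i]]_n -> 'M[R[i]]_n}).

(* The matrix with blocks A i j is an arbitrary element of the k x k matrices
   over 'M_n, and its image under id (x) F has blocks F (A i j). *)
Definition completely_positive F : Prop :=
  forall (k : nat) (A : 'I_k -> 'I_k -> 'M[R[i]]_n),
    psdmx (\mxblock_(i < k, j < k) A i j) ->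
    psdmx (\mxblock_(i < k, j < k) F (A i j)).

(* Only the values of Phi at nonnegative times are meaningful. *)
Record quantum_markov_semigroup Phi : Prop := {
  qms_cp : forall t : R, 0 <= t -> completely_positive (Phi t) ;
  qms_unital : forall t : R, 0 <= t -> Phi t 1%:M = 1%:M ;
  qms_0 : forall X, Phi 0 X = X ;
  qms_add : forall s t : R, 0 <= s -> 0 <= t ->
    forall X, Phi (s + t) X = Phi s (Phi t X) ;
  qms_norm_continuous : forall s : R, 0 <= s ->
    map_norm opnorm (fun X => Phi t X - Phi s X)
      @[t --> within [set t | 0 <= t] (nbhs s)] --> (0 : R) }.

(* Phi t = exp (- t L), the exponential series converging in operator norm. *)
Definition is_generator Phi L : Prop :=
  forall t : R, 0 <= t ->
    map_norm opnorm (fun X =>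
        Phi t X - \sum_(k < N) ((- t) ^+ k / k`!%:R)%:C *: iter k L X)
      @[N --> \oo] --> (0 : R).

Definition kms_symmetric D Phi : Prop :=
  forall t : R, 0 <= t -> forall X Y, kms D X (Phi t Y) = kms D (Phi t X) Y.

Definition invariant_density D Phi : Prop :=
  forall t : R, 0 <= t -> forall X, state D (Phi t X) = state D X.

Definition primitive Phi L : Prop :=
  (exists D, faithful_density D /\ invariant_density D Phi) /\
  (forall X, L X = 0 <-> exists c : R[i], X = c%:M).

(* The real parts only change the type: <P, L P> is real when L is
   KMS-symmetric, and the state of a projection is real. *)
Definition conductance D L : R :=
  inf [set complex.Re (kms D P (L P)) /
             Num.min (complex.Re (state D P)) (1 - complex.Re (state D P))
      | P in [set P | [/\ orthogonal_projection P, P != 0 & P != 1%:M]]].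

(* The adjoint for the bilinear trace pairing (see [tr_adjointP]). *)
Definition tr_adjoint F (D : 'M[R[i]]_n) : 'M[R[i]]_n :=
  \matrix_(i, j) \tr (D *m F (delta_mx j i)).

(* Extended-real valued, so that the infimum of the empty set is +oo. *)
Definition mixing_time D Phi (eps : R) : \bar R :=
  ereal_inf [set t%:E | t in [set t : R | 0 <= t /\
    sup [set trnorm (tr_adjoint (Phi t) D' - D) | D' in [set D' | density_matrix D']]
      <= 2 * eps]].

End Semigroups.

Section Checks.
Context {R : realType} {n : nat}.
Implicit Types (A D X : 'M[R[i]]_n).
Implicit Types (F G : {linear 'M[R[i]]_n -> 'M[R[i]]_n}).

Lemma tr_adjointP F D X : \tr (tr_adjoint F D *m X) = \tr (D *m F X).
Proof.
rewrite {2}[X]matrix_sum_delta linear_sum mulmx_sumr raddf_sum /=.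
under [RHS]eq_bigr => i _ do rewrite linear_sum mulmx_sumr raddf_sum /=.
rewrite exchange_big; apply: eq_bigr => i _ /=.
rewrite mxE; apply: eq_bigr => j _.
by rewrite mxE linearZ /= -scalemxAr mxtraceZ mulrC.
Qed.

Lemma psdmx_hermitian A : psdmx A -> A^t* = A.
Proof.
move=> A0; pose B := A^t* - A.
have q0 (v : 'cV[R[i]]_n) : (v^t* *m B *m v) 0 0 = 0.
  have /ger0_real/CrealP vAv := A0 v.
  have conjq : ((v^t* *m A *m v)^t*) 0 0 = (v^t* *m A *m v) 0 0.
    by rewrite -[RHS]vAv mxE; congr (Num.conj _); rewrite mxE.
  rewrite /B mulmxBr mulmxBl [LHS]mxE [X in _ + X]mxE.
  by rewrite -[X in _ - X]conjq !trmx_mul !map_mxM trmxCK mulmxA subrr.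
have BE : B = A^t* - A by [].
clearbody B; have bil (u v : 'cV[R[i]]_n) :
    (u^t* *m B *m v) 0 0 + (v^t* *m B *m u) 0 0 = 0.
  have := q0 (u + v).
  have -> : (u + v)^t* = u^t* + v^t*.
    by apply/matrixP => i j; rewrite !mxE rmorphD.
  rewrite !mulmxDl !mulmxDr.
  have addE (X Y : 'M[R[i]]_1) : (X + Y) 0 0 = X 0 0 + Y 0 0 by rewrite mxE.
  by rewrite !addE !q0 add0r addr0 addrC.
have e2 (a : R[i]) (u v : 'cV[R[i]]_n) :
    (u^t* *m B *m (a *: v)) 0 0 = a * (u^t* *m B *m v) 0 0.
  by rewrite -scalemxAr mxE.
have e1 (a : R[i]) (u v : 'cV[R[i]]_n) :
    ((a *: v)^t* *m B *m u) 0 0 = a^* * (v^t* *m B *m u) 0 0.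
  have -> : (a *: v)^t* = a^* *: v^t*.
    by apply/matrixP => i j; rewrite !mxE rmorphM.
  by rewrite -!scalemxAl mxE.
have B0 (u v : 'cV[R[i]]_n) : (u^t* *m B *m v) 0 0 = 0.
  have h1 := bil u v.
  have h2 := bil u ('i%C *: v); rewrite e2 e1 in h2.
  have i0 : ('i%C : R[i]) != 0 by rewrite eq_complex /= oner_eq0 andbF.
  have : 'i%C * ((u^t* *m B *m v) 0 0 - (v^t* *m B *m u) 0 0) = 0.
    rewrite -h2 mulrBr; congr (_ + _); rewrite -mulNr; congr (_ * _).
    by apply/eqP; rewrite eq_complex /= oppr0 !eqxx.
  move/eqP; rewrite mulf_eq0 (negbTE i0) /= subr_eq0 => /eqP h3.
  move: h1; rewrite -h3 -mulr2n => /eqP.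
  by rewrite mulrn_eq0 /= => /eqP.
apply/eqP; rewrite -subr_eq0 -BE; apply/eqP/matrixP => i j.
have := B0 (delta_mx i 0) (delta_mx j 0).
by rewrite trmx_delta map_delta_mx -rowE -colE !mxE.
Qed.

Lemma psdmx_spectral A : psdmx A ->
  A = invmx (spectralmx A) *m diag_mx (spectral_diag A) *m spectralmx A.
Proof.
move=> /psdmx_hermitian AE; apply/orthomx_spectralP.
by apply/normalmxP; rewrite AE.
Qed.

Lemma spectral_diag_ge0 A i : psdmx A -> 0 <= spectral_diag A 0 i.
Proof.
move=> A0; have U := spectral_unitarymx A; have Uu := spectral_unit A.
have := A0 ((spectralmx A)^t* *m delta_mx i 0).
rewrite {2}(psdmx_spectral A0) invmx_unitary// !trmx_mul !map_mxM trmxCK.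
have UU : spectralmx A *m (spectralmx A)^t* = 1%:M by apply/unitarymxP.
rewrite !mulmxA -(mulmxA _ (spectralmx A)) UU mulmx1.
rewrite -(mulmxA _ (spectralmx A)) UU mulmx1.
by rewrite trmx_delta map_delta_mx -rowE -colE !mxE eqxx mulr1n.
Qed.

Lemma mxsqrtK A : psdmx A -> mxsqrt A *m mxsqrt A = A.
Proof.
move=> A0; have Uu := spectral_unit A.
rewrite [RHS](psdmx_spectral A0) /mxsqrt !mulmxA mulmxK//.
rewrite -(mulmxA _ (diag_mx _) (diag_mx _)) mulmx_diag; congr (_ *m diag_mx _ *m _).
by apply/rowP => j; rewrite !mxE -expr2 sqrtCK.
Qed.

Lemma mxsqrt_psd A : psdmx A -> psdmx (mxsqrt A).
Proof.
move=> A0 v; rewrite /mxsqrt invmx_unitary ?spectral_unitarymx//.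
set w := spectralmx A *m v.
have -> : v^t* *m ((spectralmx A)^t* *m diag_mx (map_mx sqrtC (spectral_diag A))
    *m spectralmx A) *m v = w^t* *m diag_mx (map_mx sqrtC (spectral_diag A)) *m w.
  by rewrite /w trmx_mul map_mxM !mulmxA.
rewrite mul_mx_diag mxE sumr_ge0// => j _; rewrite !mxE.
rewrite mulrAC mulr_ge0 ?sqrtC_ge0 ?spectral_diag_ge0//.
by rewrite mulrC mul_conjC_ge0.
Qed.

End Checks.

(* Main.v *)
Require Import Defs.
From HB Require Import structures.
From mathcomp Require Import all_boot all_order all_algebra.
From mathcomp Require Import spectral complex.
From mathcomp Require Import all_classical all_reals all_analysis.
From mathcomp Require Import ring lra.
Import Order.TTheory GRing.Theory Num.Theory.
Import numFieldNormedType.Exports.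

(** The crux is a Cheeger inequality for the spectral gap. If F is completely
    positive, unital and KMS-symmetric, there are matrices V_j with
    <X, X - F X> = sum_j |[V_j, X]|^2 (KMS norms) for Hermitian X: the Choi matrix
    of sum_j V_j^* . V_j is obtained from that of F by solving a Lyapunov
    equation, which preserves positivity. Comparing the KMS and Hilbert-Schmidt
    norms of the commutators, the Dirichlet form of F on the functions of a fixed
    Hermitian X lies between s_- and s_+ times the energy of a weighted graph on
    the spectrum of X. The classical Cheeger argument for F = Phi_t, divided by t
    and with t -> 0, gives s_-^2 h^2 <= 2 s_+^2 |L| lambda for every nonzero
    eigenvalue lambda of L, and the upper bound follows by the chi-square estimate
    of the trace distance.
    For the lower bound, the KMS variance of a projection dominates
    2 sqrt(s_+ s_-) / (s_- + s_+) times its GNS variance p (1 - p), so h controls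
    the gap from above, while an eigenvector of the gap, tested against its extremal
    spectral projection, cannot mix faster than exp(- lambda t). *)

Set Implicit Arguments.
Unset Strict Implicit.
Unset Printing Implicit Defensive.

Local Open Scope classical_set_scope.
Local Open Scope complex_scope.
Local Open Scope sesquilinear_scope.
Local Open Scope ring_scope.

(** * Matrices over the complex numbers *)

(** KMS symmetry does not make the semigroup commute with X -> D X D^-1, so Kraus operators that are
    eigenvectors of that map, the usual source of commutator formulas, are not at hand; the Lyapunov
    equation takes their place. Working with Phi_t instead of L makes complete positivity directly
    usable and avoids any normal form of the generator. The price is that the graph varies with t.
    The level sets and the median depend only on X, so the inequality they satisfy can be stated in
    Dirichlet forms alone and passed to the limit. The eigenbasis of X need not diagonalize D; the
    vertex measure is the diagonal of D in that basis. Constants: s_+^2 comes from bounding the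
    forms of the level sets by graph energies, s_-^2 from the two energies on the other side of
    Cauchy-Schwarz, 2 from (u + v)^2 <= 2 (u^2 + v^2), and |L| from the vertex degrees, which are
    Dirichlet forms of rank-one projections. In the lower bound the factor 2 of the variance
    comparison is used up by min(p, 1 - p) <= 2 p (1 - p). The root of 1/s_- - 1 bounds the
    chi-square distance at time 0. *)

Section SquaredModulus.
Context {R : realType}.
Implicit Types (z w : R[i]).

Definition nsq z : R := complex.Re z ^+ 2 + complex.Im z ^+ 2.

Lemma nsqE z : (nsq z)%:C = z^* * z.
Proof. by rewrite add_Re2_Im2 normCK mulrC. Qed.

Lemma nsq_ge0 z : 0 <= nsq z.
Proof. by rewrite addr_ge0 ?sqr_ge0. Qed.

Lemma nsq_eq0 z : (nsq z == 0) = (z == 0).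
Proof.
by rewrite /nsq paddr_eq0 ?sqr_ge0// !sqrf_eq0 [RHS]eq_complex.
Qed.

Lemma nsq0 : nsq 0 = 0.
Proof. by apply/eqP; rewrite nsq_eq0. Qed.

Lemma nsqM z w : nsq (z * w) = nsq z * nsq w.
Proof.
apply: complexI; rewrite rmorphM/= !nsqE rmorphM/=.
by rewrite mulrACA.
Qed.

Lemma nsq_conj z : nsq z^* = nsq z.
Proof. by apply: complexI; rewrite !nsqE conjCK mulrC. Qed.

Lemma nsqN z : nsq (- z) = nsq z.
Proof. by apply: complexI; rewrite !nsqE rmorphN mulrNN. Qed.

Lemma nsq_real (x : R) : nsq x%:C = x ^+ 2.
Proof. by rewrite /nsq /= expr0n addr0. Qed.

Lemma conjC_real (x : R) : (x%:C)^* = x%:C.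
Proof. exact: conjc_real. Qed.

Lemma real_complexK z : z^* = z -> z = (complex.Re z)%:C.
Proof. by move=> /CrealP zr; rewrite RRe_real. Qed.

End SquaredModulus.

Section Adjoint.
Context {C : numClosedFieldType}.

Lemma trmxCM m n p (A : 'M[C]_(m, n)) (B : 'M[C]_(n, p)) :
  (A *m B)^t* = B^t* *m A^t*.
Proof. by rewrite trmx_mul map_mxM. Qed.

Lemma trmxCD m n (A B : 'M[C]_(m, n)) : (A + B)^t* = A^t* + B^t*.
Proof. by apply/matrixP => i j; rewrite !mxE rmorphD. Qed.

Lemma trmxCN m n (A : 'M[C]_(m, n)) : (- A)^t* = - A^t*.
Proof. by apply/matrixP => i j; rewrite !mxE rmorphN. Qed.

Lemma trmxCB m n (A B : 'M[C]_(m, n)) : (A - B)^t* = A^t* - B^t*.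
Proof. by rewrite trmxCD trmxCN. Qed.

Lemma trmxCZ m n (c : C) (A : 'M[C]_(m, n)) : (c *: A)^t* = c^* *: A^t*.
Proof. by apply/matrixP => i j; rewrite !mxE rmorphM. Qed.

Lemma trmxC_scalar n (c : C) : (c%:M : 'M[C]_n)^t* = (c^*)%:M.
Proof. by rewrite tr_scalar_mx map_scalar_mx. Qed.

Lemma trmxC1 n : (1%:M : 'M[C]_n)^t* = 1%:M.
Proof. by rewrite trmxC_scalar rmorph1. Qed.

Lemma trmxC_delta m n (i : 'I_m) (j : 'I_n) :
  (delta_mx i j : 'M[C]_(m, n))^t* = delta_mx j i.
Proof. by rewrite trmx_delta map_delta_mx. Qed.

Lemma mxtrace_trmxC n (A : 'M[C]_n) : \tr (A^t*) = (\tr A)^*.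
Proof. by rewrite -mxtrace_tr raddf_sum; apply: eq_bigr => i _; rewrite !mxE. Qed.

End Adjoint.

Section HilbertSchmidt.
Context {R : realType}.
Local Notation C := R[i].

Definition hs2 m n (A : 'M[C]_(m, n)) : R := \sum_i \sum_j nsq (A i j).

Lemma hs2E m n (A : 'M[C]_(m, n)) : \tr (A^t* *m A) = (hs2 A)%:C.
Proof.
rewrite /hs2 exchange_big rmorph_sum; apply: eq_bigr => j _ /=.
rewrite mxE rmorph_sum; apply: eq_bigr => i _ /=.
by rewrite !mxE nsqE.
Qed.

Lemma hs2_ge0 m n (A : 'M[C]_(m, n)) : 0 <= hs2 A.
Proof. by do 2![apply: sumr_ge0 => ? _]; exact: nsq_ge0. Qed.

Lemma hs2_eq0 m n (A : 'M[C]_(m, n)) : (hs2 A == 0) = (A == 0).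
Proof.
apply/eqP/eqP => [A0|->]; last first.
  by apply: big1 => i _; apply: big1 => j _; rewrite mxE nsq0.
apply/matrixP => i j; apply/eqP; rewrite mxE -nsq_eq0.
move/eqP: A0; rewrite psumr_eq0 => [|k _]; last first.
  by apply: sumr_ge0 => ? _; exact: nsq_ge0.
move=> /allP/(_ i (mem_index_enum _)) /=.
rewrite psumr_eq0 => [|k _]; last exact: nsq_ge0.
by move=> /allP/(_ j (mem_index_enum _)).
Qed.

Lemma hs2_trmxC m n (A : 'M[C]_(m, n)) : hs2 (A^t*) = hs2 A.
Proof.
rewrite /hs2 exchange_big; apply: eq_bigr => i _; apply: eq_bigr => j _.
by rewrite !mxE nsq_conj.
Qed.

Lemma hs2_unitaryl m n (U : 'M[C]_m) (A : 'M[C]_(m, n)) :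
  U^t* *m U = 1%:M -> hs2 (U *m A) = hs2 A.
Proof.
move=> UU; apply: complexI; rewrite -!hs2E trmxCM mulmxA -(mulmxA (A^t*)) UU.
by rewrite mulmx1.
Qed.

Lemma hs2_unitaryr m n (U : 'M[C]_n) (A : 'M[C]_(m, n)) :
  U *m U^t* = 1%:M -> hs2 (A *m U) = hs2 A.
Proof.
by move=> UU; rewrite -hs2_trmxC trmxCM hs2_unitaryl ?trmxCK// hs2_trmxC.
Qed.

End HilbertSchmidt.

Section Spectral.
Context {R : realType}.
Local Notation C := R[i].

Definition rdiag n (d : 'I_n -> R) : 'M[C]_n := diag_mx (\row_i (d i)%:C).

Lemma rdiagE n (d : 'I_n -> R) i j : rdiag d i j = (d i)%:C *+ (i == j).
Proof. by rewrite !mxE. Qed.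

Lemma trmxC_rdiag n (d : 'I_n -> R) : (rdiag d)^t* = rdiag d.
Proof.
apply/matrixP => i j; rewrite !mxE eq_sym.
by case: eqP => [->|]; rewrite ?mulr1n ?mulr0n ?conjC_real ?conjC0.
Qed.

Lemma rdiagM n (d e : 'I_n -> R) :
  rdiag d *m rdiag e = rdiag (fun i => d i * e i).
Proof.
rewrite /rdiag mulmx_diag; congr diag_mx.
by apply/rowP => j; rewrite !mxE rmorphM.
Qed.

Lemma mul_rdiag_mx m n (d : 'I_n -> R) (A : 'M[C]_(n, m)) i j :
  (rdiag d *m A) i j = (d i)%:C * A i j.
Proof. by rewrite mul_diag_mx !mxE. Qed.

Lemma mul_mx_rdiag m n (d : 'I_n -> R) (A : 'M[C]_(m, n)) i j :
  (A *m rdiag d) i j = A i j * (d j)%:C.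
Proof. by rewrite mul_mx_diag !mxE. Qed.

Lemma rdiag1 n : rdiag (fun _ : 'I_n => 1) = 1%:M.
Proof. by apply/matrixP => i j; rewrite !mxE. Qed.

Lemma spectralmx_adjK n (A : 'M[C]_n) : spectralmx A *m (spectralmx A)^t* = 1%:M.
Proof. exact/unitarymxP/spectral_unitarymx. Qed.

Lemma spectralmxK n (A : 'M[C]_n) : (spectralmx A)^t* *m spectralmx A = 1%:M.
Proof. exact/mulmx1C/spectralmx_adjK. Qed.

Lemma hermitian_spectral n (A : 'M[C]_n) : A^t* = A ->
  exists2 d : 'I_n -> R, spectral_diag A = \row_i (d i)%:C &
    A = (spectralmx A)^t* *m rdiag d *m spectralmx A.
Proof.
move=> AE; have Anormal : A \is normalmx by apply/normalmxP; rewrite AE.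
have /orthomx_spectralP Asp := Anormal.
rewrite invmx_unitary ?spectral_unitarymx// in Asp.
set U := spectralmx A in Asp *; set s := spectral_diag A in Asp *.
have sE : diag_mx s = U *m A *m U^t*.
  rewrite Asp !mulmxA spectralmx_adjK mul1mx -mulmxA spectralmx_adjK.
  by rewrite mulmx1.
have sr i : (s 0 i)^* = s 0 i.
  have : (diag_mx s)^t* = diag_mx s.
    by rewrite sE !trmxCM trmxCK AE mulmxA.
  by move=> /matrixP/(_ i i); rewrite !mxE eqxx !mulr1n.
have sd : s = \row_i (complex.Re (s 0 i))%:C.
  by apply/rowP => i; rewrite mxE; apply/real_complexK/sr.
exists (fun i => complex.Re (s 0 i)) => //.
by rewrite /rdiag -sd.
Qed.

(* [T = B - B'] solves the Sylvester equation [B T + T B' = 0], which at an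
   eigenvector [v] of [T] reads [tau <v, (B + B') v> = 0]. *)
Lemma psd_root_uniq n (B B' : 'M[C]_n) : psdmx B -> psdmx B' ->
  B *m B = B' *m B' -> B = B'.
Proof.
move=> B0 B'0 BB.
have TE : B *m (B - B') + (B - B') *m B' = 0.
  by rewrite mulmxBl mulmxBr BB addrA subrK subrr.
set T := B - B' in TE.
have Th : T^t* = T by rewrite /T trmxCB !psdmx_hermitian.
have [t _ Tsp] := hermitian_spectral Th.
set U := spectralmx T in Tsp.
suff t0 : forall i, t i = 0.
  apply/eqP; rewrite -subr_eq0 -/T Tsp.
  have -> : rdiag t = 0 by apply/matrixP => i j; rewrite !mxE t0 mul0rn.
  by rewrite mulmx0 mul0mx.
move=> i; pose v : 'cV_n := U^t* *m delta_mx i 0.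
have Tv : T *m v = (t i)%:C *: v.
  rewrite Tsp /v -!mulmxA (mulmxA U) spectralmx_adjK mul1mx scalemxAr.
  congr (_ *m _); apply/matrixP => k l; rewrite mul_rdiag_mx !mxE.
  by case: (k =P i) => [->|]//=; rewrite !mulr0.
have vT : v^t* *m T = (t i)%:C *: v^t*.
  by rewrite -{1}Th -trmxCM Tv trmxCZ conjC_real.
have vv : v^t* *m v = 1%:M.
  rewrite /v trmxCM trmxCK mulmxA -(mulmxA _ U) spectralmx_adjK mulmx1 trmxC_delta.
  by apply/matrixP => k l; rewrite mul_delta_mx !mxE !ord1.
have eq0 : (t i)%:C * ((v^t* *m B *m v) 0 0 + (v^t* *m B' *m v) 0 0) = 0.
  have : (v^t* *m (B *m T + T *m B') *m v) 0 0 = 0.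
    by rewrite TE mulmx0 mul0mx mxE.
  rewrite mulmxDr mulmxDl mxE mulrDr => <-; congr (_ + _).
    by rewrite -!mulmxA Tv -!scalemxAr [RHS]mxE.
  by rewrite !mulmxA vT -!scalemxAl [RHS]mxE.
have /eqP := eq0; rewrite mulf_eq0 => /orP[/eqP[]//|].
rewrite paddr_eq0 ?B0 ?B'0// => /andP[/eqP v1 /eqP v2].
have : (v^t* *m T *m v) 0 0 = 0.
  by rewrite /T mulmxBr mulmxBl [LHS]mxE [X in _ + X]mxE v1 v2 subrr.
by rewrite vT -scalemxAl vv !mxE mulr1 => -[].
Qed.

Lemma psd_conj_rdiag n (U : 'M[C]_n) (d : 'I_n -> R) :
  (forall i, 0 <= d i) -> psdmx (U^t* *m rdiag d *m U).
Proof.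
move=> d0 v; have -> : v^t* *m (U^t* *m rdiag d *m U) *m v =
    (U *m v)^t* *m rdiag d *m (U *m v) by rewrite trmxCM !mulmxA.
rewrite mxE sumr_ge0// => j _.
by rewrite mul_mx_rdiag mulrAC mulr_ge0 ?ler0c// !mxE -nsqE ler0c nsq_ge0.
Qed.

Lemma conj_unitaryM n (U A B : 'M[C]_n) : U *m U^t* = 1%:M ->
  (U^t* *m A *m U) *m (U^t* *m B *m U) = U^t* *m (A *m B) *m U.
Proof. by move=> UU; rewrite !mulmxA -(mulmxA _ U) UU mulmx1. Qed.

(** When [V] diagonalizes a Hermitian X, these are the real functions of the eigenvectors of X; an
    indicator [z] gives a projection onto a span of eigenvectors. *)
Definition udiag n (V : 'M[C]_n) (z : 'I_n -> R) : 'M[C]_n := V^t* *m rdiag z *m V.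

Lemma udiag_trmxC n (V : 'M[C]_n) z : (udiag V z)^t* = udiag V z.
Proof. by rewrite /udiag (trmxCM (_ *m _)) trmxCM trmxCK trmxC_rdiag mulmxA. Qed.

Lemma udiagM n (V : 'M[C]_n) z z' : V *m V^t* = 1%:M ->
  udiag V z *m udiag V z' = udiag V (fun i => z i * z' i).
Proof. by move=> VV; rewrite /udiag (conj_unitaryM _ _ VV) rdiagM. Qed.

Lemma udiag1 n (V : 'M[C]_n) : V^t* *m V = 1%:M -> udiag V (fun=> 1) = 1%:M.
Proof. by move=> VV; rewrite /udiag rdiag1 mulmx1 VV. Qed.

Lemma udiag_inj n (V : 'M[C]_n) z z' i : V *m V^t* = 1%:M ->
  udiag V z = udiag V z' -> z i = z' i.
Proof.
move=> VV /(congr1 (fun A => V *m A *m V^t*)); rewrite /udiag !mulmxA VV !mul1mx.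
rewrite -!(mulmxA _ V) VV !mulmx1 => /matrixP/(_ i i); rewrite !rdiagE eqxx.
by case.
Qed.

Lemma mxtrace_mul_udiag n (V B : 'M[C]_n) z :
  \tr (B *m udiag V z) = \sum_i (V *m B *m V^t*) i i * (z i)%:C.
Proof.
have -> : \tr (B *m udiag V z) = \tr (V *m B *m V^t* *m rdiag z).
  by rewrite /udiag !mulmxA mxtrace_mulC !mulmxA.
by rewrite /mxtrace; apply: eq_bigr => i _; rewrite mul_mx_rdiag.
Qed.

Lemma Re_mxtrace_mul_udiag n (V B : 'M[C]_n) z :
  complex.Re (\tr (B *m udiag V z)) =
  \sum_i complex.Re ((V *m B *m V^t*) i i) * z i.
Proof.
(* [Re] is additive only for the real structure of [R[i]], which the type [Rcomplex R] carries. *)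
rewrite mxtrace_mul_udiag (raddf_sum (@complex.Re R : Rcomplex R -> R)).
apply: eq_bigr => i _; case: ((V *m B *m V^t*) i i) => a b /=.
by rewrite mulr0 subr0.
Qed.

Lemma mxtrace_udiag n (V : 'M[C]_n) z : V *m V^t* = 1%:M ->
  \tr (udiag V z) = (\sum_i z i)%:C.
Proof.
move=> VV; rewrite -[udiag V z]mul1mx mxtrace_mul_udiag mulmx1 VV rmorph_sum.
by apply: eq_bigr => i _; rewrite mxE eqxx mul1r.
Qed.

(** [mxabs] is built from the eigenbasis that [spectralmx] picks for T^t* T, which has no relation
    to [U]; uniqueness of the positive root makes the choice of basis immaterial. *)
Lemma mxabs_conj_rdiag n (U : 'M[C]_n) (d : 'I_n -> R) : U *m U^t* = 1%:M ->
  mxabs (U^t* *m rdiag d *m U) = U^t* *m rdiag (fun i => `|d i|) *m U.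
Proof.
move=> UU; rewrite /mxabs; set T := U^t* *m _ *m U.
have TT : psdmx (T^t* *m T).
  by move=> v; rewrite mulmxA -trmxCM -mulmxA mxE sumr_ge0// => j _;
     rewrite !mxE -nsqE ler0c nsq_ge0.
apply: psd_root_uniq; [exact: mxsqrt_psd | exact: psd_conj_rdiag |].
have TE : T^t* = T by rewrite /T !trmxCM trmxCK trmxC_rdiag mulmxA.
rewrite (mxsqrtK TT) TE /T (conj_unitaryM _ _ UU) (conj_unitaryM _ _ UU) !rdiagM.
have -> : (fun i => `|d i| * `|d i|) = (fun i => d i * d i); last by [].
by apply/funext => i; rewrite -normrM ger0_norm// -expr2 sqr_ge0.
Qed.

Lemma trnorm_conj_rdiag n (U : 'M[C]_n) (d : 'I_n -> R) : U *m U^t* = 1%:M ->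
  trnorm (U^t* *m rdiag d *m U) = \sum_i `|d i|.
Proof.
move=> UU; rewrite /trnorm mxabs_conj_rdiag// -mulmxA mxtrace_mulC -mulmxA UU.
rewrite mulmx1 /mxtrace.
have -> : \sum_i rdiag (fun i => `|d i|) i i = (\sum_i `|d i|)%:C.
  by rewrite rmorph_sum; apply: eq_bigr => i _; rewrite rdiagE eqxx.
by [].
Qed.

End Spectral.

(** * Complete positivity and Choi matrices *)

Lemma sum_pairE (V : nmodType) (I J : finType) (f : I * J -> V) :
  \sum_p f p = \sum_i \sum_j f (i, j).
Proof. by rewrite pair_bigA; apply: eq_bigr => -[]. Qed.

Section PsdKernels.
Context {R : realType}.
Local Notation C := R[i].

Lemma mx_sesquiE n (A : 'M[C]_n) (u v : 'cV[C]_n) :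
  (u^t* *m A *m v) 0 0 = \sum_i \sum_j (u i 0)^* * A i j * v j 0.
Proof.
rewrite mxE exchange_big; apply: eq_bigr => j _ /=.
rewrite mxE big_distrl; apply: eq_bigr => i _ /=.
by rewrite !mxE.
Qed.

Lemma psd_conj_sym n (A : 'M[C]_n) i j : psdmx A -> (A i j)^* = A j i.
Proof. by move=> /psdmx_hermitian /matrixP /(_ j i); rewrite !mxE. Qed.

(* Lyapunov: at an eigenvector [v] of the solution [M], with eigenvalue [m],
   [0 <= <v, W v> = 2 m <v, diag(a) v>]. *)
Lemma psd_lyapunov n (W : 'M[C]_n) (a : 'I_n -> R) : (forall i, 0 < a i) ->
  psdmx W -> psdmx (\matrix_(i, j) (W i j / (a i + a j)%:C)).
Proof.
move=> a0 W0; set M := \matrix_(i, j) _.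
have ME : rdiag a *m M + M *m rdiag a = W.
  apply/matrixP => i j; rewrite mxE mul_rdiag_mx mul_mx_rdiag mxE.
  rewrite [(a i)%:C * _]mulrC -mulrDr -rmorphD/= divfK//.
  by rewrite -(rmorph0 (real_complex R)) (inj_eq (@complexI _)) gt_eqF ?addr_gt0.
have Mh : M^t* = M.
  apply/matrixP => i j; rewrite !mxE rmorphM/= psd_conj_sym// fmorphV/=.
  by rewrite conjC_real addrC.
have [m _ Msp] := hermitian_spectral Mh.
set U := spectralmx M in Msp.
suff m0 i : 0 <= m i by rewrite Msp; exact: psd_conj_rdiag.
pose v : 'cV_n := U^t* *m delta_mx i 0.
have Mv : M *m v = (m i)%:C *: v.
  rewrite Msp /v -!mulmxA (mulmxA U) spectralmx_adjK mul1mx scalemxAr.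
  congr (_ *m _); apply/matrixP => k l; rewrite mul_rdiag_mx !mxE.
  by case: (k =P i) => [->|]//=; rewrite !mulr0.
have vM : v^t* *m M = (m i)%:C *: v^t*.
  by rewrite -{1}Mh -trmxCM Mv trmxCZ conjC_real.
pose q := \sum_k a k * nsq (v k 0).
have vav : (v^t* *m rdiag a *m v) 0 0 = q%:C.
  rewrite mxE rmorph_sum; apply: eq_bigr => k _ /=.
  by rewrite mul_mx_rdiag !mxE mulrAC mulrC rmorphM/= nsqE.
have : 0 <= (v^t* *m W *m v) 0 0 by exact: W0.
have -> : (v^t* *m W *m v) 0 0 = (m i * q *+ 2)%:C.
  rewrite -ME mulmxDr mulmxDl mxE mulr2n rmorphD rmorphM/= -vav; congr (_ + _).
    by rewrite -!mulmxA Mv -!scalemxAr [LHS]mxE.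
  by rewrite !mulmxA vM -!scalemxAl [LHS]mxE.
have q0 : 0 <= q by apply: sumr_ge0 => k _; rewrite mulr_ge0 ?nsq_ge0// ltW.
suff q_gt0 : 0 < q by rewrite ler0c pmulrn_lge0// pmulr_lge0.
rewrite lt0r q0 andbT; apply/negP; rewrite psumr_eq0; last first.
  by move=> k _; rewrite mulr_ge0 ?nsq_ge0// ltW.
move=> /allP vz; have : v = 0.
  apply/matrixP => k l; rewrite ord1 [RHS]mxE; have := vz k (mem_index_enum _).
  by rewrite /= mulf_eq0 gt_eqF//= nsq_eq0 => /eqP.
move=> /(congr1 (mulmx U)); rewrite mulmxA spectralmx_adjK mul1mx mulmx0.
by move=> /matrixP/(_ i 0)/eqP; rewrite !mxE !eqxx oner_eq0.
Qed.

(** The square root is a Gram factorization. Applied to a Choi matrix, its rows are the Kraus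
    operators. *)
Lemma psd_factor n (A : 'M[C]_n) : psdmx A -> exists V : 'M[C]_n,
  forall i j, A i j = \sum_k (V k i)^* * V k j.
Proof.
move=> A0; exists (mxsqrt A) => i j; rewrite -{1}(mxsqrtK A0) mxE.
by apply: eq_bigr => k _; rewrite psd_conj_sym//; exact: mxsqrt_psd.
Qed.

(** Complete positivity tested on the block matrix with blocks r_i^t* r_j, which is positive because
    its quadratic form is the squared modulus of the sum of the r_i y_i. *)
Lemma cp_quad_ge0 n (F : {linear 'M[C]_n -> 'M[C]_n}) : completely_positive F ->
  forall (k : nat) (r : 'I_k -> 'rV[C]_n) (v : 'I_k -> 'cV[C]_n),
  0 <= \sum_i \sum_j ((v i)^t* *m F ((r i)^t* *m r j) *m v j) 0 0.
Proof.
move=> Fcp k r v.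
have A0 : psdmx (\mxblock_(i < k, j < k) ((r i)^t* *m r j)).
  move=> x; have -> : x = \mxcol_i submxcol x i by rewrite submxcolK.
  set y := fun i => submxcol x i.
  have -> : (\mxcol_i y i)^t* = \mxrow_i (y i)^t*.
    by apply/matrixP => i j; rewrite !mxE.
  rewrite mul_mxrow_mxblock mul_mxrow_mxcol.
  under eq_bigr => j _.
    under eq_bigr => i _ do rewrite mulmxA.
    rewrite -mulmx_suml -mulmxA; over.
  rewrite -mulmx_sumr.
  have -> : \sum_i (y i)^t* *m (r i)^t* = (\sum_i r i *m y i)^t*.
    by apply/matrixP => a b; rewrite !mxE !summxE rmorph_sum;
       apply: eq_bigr => i _; rewrite -trmxCM !mxE.
  by rewrite mxE sumr_ge0// => a _; rewrite !mxE -nsqE ler0c nsq_ge0.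
have := Fcp k _ A0 (\mxcol_i v i).
have -> : (\mxcol_i v i)^t* = \mxrow_i (v i)^t*.
  by apply/matrixP => i j; rewrite !mxE.
rewrite mul_mxrow_mxblock mul_mxrow_mxcol summxE.
rewrite exchange_big /=.
congr (0 <= _); apply: eq_bigr => i _.
by rewrite mulmx_suml summxE.
Qed.

(* At ((b, a), (c, d)): the sum of (V b a)^* (V c d) over Kraus operators V of F. *)
Definition choi n (F : 'M[C]_n -> 'M[C]_n) : 'M[C]_#|{: 'I_n * 'I_n}| :=
  \matrix_(p, q)
    F (delta_mx (enum_val p).1 (enum_val q).1) (enum_val p).2 (enum_val q).2.

Lemma choiE n (F : 'M[C]_n -> 'M[C]_n) b a c d :
  choi F (enum_rank (b, a)) (enum_rank (c, d)) = F (delta_mx b c) a d.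
Proof. by rewrite mxE !enum_rankK. Qed.

(** For unitary [G] this is [F] read in another orthonormal basis; it reduces the commutator formula
    to a diagonal density matrix. *)
Definition conj_map n (G : 'M[C]_n) (F : 'M[C]_n -> 'M[C]_n) (X : 'M[C]_n) :=
  G *m F (G^t* *m X *m G) *m G^t*.

Lemma conj_map_is_linear n (G : 'M[C]_n) (F : {linear 'M[C]_n -> 'M[C]_n}) :
  linear (conj_map G F).
Proof.
move=> a X Y; rewrite /conj_map mulmxDr mulmxDl -scalemxAr -scalemxAl linearP.
by rewrite mulmxDr mulmxDl -scalemxAr -scalemxAl.
Qed.

HB.instance Definition _ n G (F : {linear 'M[C]_n -> 'M[C]_n}) :=
  GRing.isLinear.Build C 'M[C]_n 'M[C]_n _ (conj_map G F)
    (conj_map_is_linear G F).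

(** Slicing [v] into columns v_b, its quadratic form is the sum in [cp_quad_ge0] for the rows e_b G
    and the columns G^t* v_b. *)
Lemma choi_conj_psd n (G : 'M[C]_n) (F : {linear 'M[C]_n -> 'M[C]_n}) :
  completely_positive F -> psdmx (choi (conj_map G F)).
Proof.
move=> Fcp v; have := cp_quad_ge0 Fcp (fun b => delta_mx 0 b *m G)
    (fun b => G^t* *m \col_a v (enum_rank (b, a)) 0).
congr (0 <= _); rewrite mx_sesquiE.
pose H (p q : 'I_n * 'I_n) := (v (enum_rank p) 0)^* *
  conj_map G F (delta_mx p.1 q.1) p.2 q.2 * v (enum_rank q) 0.
transitivity (\sum_p \sum_q H p q).
  rewrite sum_pairE; apply: eq_bigr => b _.
  transitivity (\sum_c \sum_a \sum_d H (b, a) (c, d)).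
    apply: eq_bigr => c _.
    have GE (B : 'M[C]_n) (x y : 'cV[C]_n) : (G^t* *m x)^t* *m B *m (G^t* *m y) =
        x^t* *m (G *m B *m G^t*) *m y by rewrite trmxCM trmxCK !mulmxA.
    rewrite GE mx_sesquiE; apply: eq_bigr => a _; apply: eq_bigr => d _.
    rewrite /H /conj_map /= trmxCM trmxC_delta !mulmxA -(mulmxA _ (delta_mx b 0)).
    by rewrite mul_delta_mx; congr (Num.conj _ * _ * _); rewrite mxE.
  rewrite exchange_big; apply: eq_bigr => a _ /=.
  by rewrite sum_pairE.
rewrite (big_enum_val (A := {: 'I_n * 'I_n}) _) /=.
apply: eq_bigr => p _; rewrite (big_enum_val (A := {: 'I_n * 'I_n}) _) /=.
by apply: eq_bigr => q _; rewrite /H !enum_valK; congr (_ * _ * _); rewrite [RHS]mxE.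
Qed.

Lemma mx_linear_sum n (F : {linear 'M[C]_n -> 'M[C]_n}) X a d :
  F X a d = \sum_b \sum_c X b c * F (delta_mx b c) a d.
Proof.
rewrite {1}[X]matrix_sum_delta linear_sum summxE; apply: eq_bigr => b _.
by rewrite linear_sum summxE; apply: eq_bigr => c _; rewrite linearZ mxE.
Qed.

(** A positive Choi matrix is Hermitian, which is the claim on matrix units. *)
Lemma cp_trmxC n (F : {linear 'M[C]_n -> 'M[C]_n}) : completely_positive F ->
  forall X, F (X^t*) = (F X)^t*.
Proof.
move=> /(choi_conj_psd 1%:M) W0.
have FE b c a d : F (delta_mx b c) a d = (F (delta_mx c b) d a)^*.
  have FE Y : conj_map 1%:M F Y = F Y.
    by rewrite /conj_map trmxC1 mul1mx !mulmx1 mul1mx.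
  have := psd_conj_sym (enum_rank (c, d)) (enum_rank (b, a)) W0.
  by rewrite !choiE !FE.
move=> X; apply/matrixP => a d; rewrite !mxE !mx_linear_sum rmorph_sum exchange_big.
apply: eq_bigr => b _; rewrite rmorph_sum; apply: eq_bigr => c _ /=.
by rewrite rmorphM FE !mxE.
Qed.

End PsdKernels.

(** The factors [1%:M] and the bracketing give all four terms the shape A V^t* Y V B, so that
    summing over Kraus operators replaces V^t* Y V by the image of Y. *)
Lemma mxtrace_commutator {K : numClosedFieldType} n (V X S : 'M[K]_n) : X^t* = X ->
  \tr ((V *m X - X *m V)^t* *m S *m (V *m X - X *m V) *m S) =
    \tr (X *m V^t* *m S *m V *m (X *m S)) - \tr (X *m V^t* *m (S *m X) *m V *m S)
    - \tr (1%:M *m V^t* *m (X *m S) *m V *m (X *m S))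
    + \tr (1%:M *m V^t* *m (X *m S *m X) *m V *m S).
Proof.
move=> Xh.
have tr4 (A1 A2 A3 A4 : 'M[K]_n) :
    \tr (A1 - A2 - A3 + A4) = \tr A1 - \tr A2 - \tr A3 + \tr A4.
  by rewrite raddfD !raddfB.
rewrite -tr4; congr (\tr _); rewrite trmxCB (trmxCM V) (trmxCM X) Xh !mul1mx.
have dist (P Q A B : 'M[K]_n) : (P - Q) *m S *m (A - B) *m S =
    P *m S *m A *m S - P *m S *m B *m S - Q *m S *m A *m S + Q *m S *m B *m S.
  have zmodE (a b c d : 'M[K]_n) : a - b - (c - d) = a - c - b + d.
    by rewrite opprB addrA addrAC (addrAC a).
  by rewrite (mulmxBl P) mulmxBr (mulmxBl _ _ A) (mulmxBl _ _ B) !(mulmxBl _ _ S) zmodE.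
by rewrite dist !mulmxA.
Qed.

(** * Dirichlet forms as sums of squared commutators *)

Section CommutatorForm.
Context {R : realType} {n : nat}.
Local Notation C := R[i].
Implicit Types (X Y : 'M[C]_n).

Lemma mxtrace_delta_mul (i j : 'I_n) (A : 'M[C]_n) : \tr (delta_mx i j *m A) = A j i.
Proof.
rewrite /mxtrace (bigD1 i)//= big1 ?addr0 => [|k ki].
  rewrite mxE (bigD1 j)//= big1 ?addr0 ?mxE ?eqxx ?mul1r// => l lj.
  by rewrite mxE (negbTE lj) andbF mul0r.
by rewrite mxE big1// => l _; rewrite mxE (negbTE ki) mul0r.
Qed.

(* The V k are Kraus operators of the map Psi with
   S F(X) S = Psi(S X) S + S Psi(X S): its Choi matrix is that of F divided
   entrywise by s b / s a + s c / s d, the solution of a Lyapunov equation. KMS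
   symmetry of F makes Psi symmetric for the trace, and F(1) = 1 gives
   Psi(S) = S / 2, so the commutators expand to the left-hand side. *)
Lemma commutator_form_diag (s : 'I_n -> R) (F : {linear 'M[C]_n -> 'M[C]_n})
    (S := rdiag s) :
  (forall i, 0 < s i) -> psdmx (choi F) -> F 1%:M = 1%:M ->
  (forall X Y, \tr (X *m S *m F Y *m S) = \tr (F X *m S *m Y *m S)) ->
  exists N (V : 'I_N -> 'M[C]_n), forall X, X^t* = X ->
    \tr (X *m S *m X *m S) - \tr (X *m S *m F X *m S) =
    \sum_k \tr ((V k *m X - X *m V k)^t* *m S *m (V k *m X - X *m V k) *m S).
Proof.
move=> s0 F0 F1 Fsym.
pose z i : C := (s i)%:C.
have z0 i : z i != 0.
  by rewrite -(rmorph0 (real_complex R)) (inj_eq (@complexI _)) gt_eqF.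
have zD0 a b c d : z b * z d + z a * z c != 0.
  rewrite -!rmorphM -rmorphD -(rmorph0 (real_complex R)) (inj_eq (@complexI _)).
  by rewrite gt_eqF// addr_gt0// mulr_gt0.
pose r (p : 'I_#|{: 'I_n * 'I_n}|) : R := s (enum_val p).1 / s (enum_val p).2.
have r0 p : 0 < r p by rewrite divr_gt0.
have [V0 V0E] := psd_factor (psd_lyapunov r0 F0).
pose V k := \matrix_(b, a) V0 k (enum_rank (b, a)).
pose K b a c d := \sum_k (V k b a)^* * V k c d.
have FK b a c d : F (delta_mx b c) a d = K b a c d * (z b / z a + z c / z d).
  have := V0E (enum_rank (b, a)) (enum_rank (c, d)).
  rewrite mxE choiE /r !enum_rankK/= => KE.
  have -> : K b a c d = F (delta_mx b c) a d / (s b / s a + s c / s d)%:C.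
    by rewrite KE; apply: eq_bigr => k _; rewrite !mxE.
  rewrite rmorphD !fmorph_div/= -!/(z _) divfK//.
  have -> : z b / z a + z c / z d = (z b * z d + z a * z c) / (z a * z d).
    by field; rewrite !z0.
  by rewrite mulf_neq0// invr_eq0 mulf_neq0.
have FK' b a c d : z a * F (delta_mx b c) a d * z d =
    K b a c d * (z b * z d + z a * z c).
  by rewrite FK; field; rewrite !z0.
(* KMS symmetry on the matrix units [delta_mx d a] and [delta_mx b c]. The multiplier z b z d + z a
   z c is invariant under this exchange of indices, hence cancels. *)
have Ksym b a c d : K b a c d = K d c a b.
  apply: (mulIf (zD0 a b c d)); rewrite -FK'.
  rewrite [z b * z d]mulrC [z a * z c]mulrC -FK'.
  have := Fsym (delta_mx d a) (delta_mx b c).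
  rewrite -!mulmxA mxtrace_delta_mul mul_rdiag_mx mul_mx_rdiag mulrA => ->.
  rewrite mxtrace_mulC -!mulmxA mxtrace_mulC -!mulmxA mxtrace_delta_mul.
  by rewrite mul_rdiag_mx mul_mx_rdiag mulrA.
pose Psi X := \sum_k (V k)^t* *m X *m V k.
have PsiE X a d : Psi X a d = \sum_b \sum_c X b c * K b a c d.
  rewrite /Psi summxE.
  under [RHS]eq_bigr => b _.
    under eq_bigr => c _ do rewrite mulr_sumr.
    rewrite exchange_big; over.
  rewrite exchange_big; apply: eq_bigr => k _ /=.
  rewrite mxE; under [LHS]eq_bigr => c _ do rewrite mxE big_distrl.
  rewrite exchange_big; apply: eq_bigr => b _; apply: eq_bigr => c _ /=.
  by rewrite !mxE; ring.
have FPsi X : S *m F X *m S = Psi (S *m X) *m S + S *m Psi (X *m S).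
  apply/matrixP => a d; rewrite mul_mx_rdiag mul_rdiag_mx mxE mul_mx_rdiag.
  rewrite mul_rdiag_mx mx_linear_sum !PsiE !mulr_sumr !mulr_suml -big_split.
  apply: eq_bigr => b _ /=; rewrite !mulr_sumr !mulr_suml -big_split.
  apply: eq_bigr => c _ /=; rewrite mul_rdiag_mx mul_mx_rdiag -!/(z _).
  transitivity (X b c * (z a * F (delta_mx b c) a d * z d)); first by ring.
  by rewrite FK'; ring.
have Psi_sym X Y : \tr (Y *m Psi X) = \tr (Psi Y *m X).
  rewrite /mxtrace.
  transitivity (\sum_d \sum_a \sum_b \sum_c Y d a * X b c * K b a c d).
    apply: eq_bigr => d _; rewrite mxE; apply: eq_bigr => a _.
    rewrite PsiE mulr_sumr; apply: eq_bigr => b _.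
    by rewrite mulr_sumr; apply: eq_bigr => c _; rewrite mulrA.
  transitivity (\sum_c \sum_b \sum_d \sum_a Y d a * X b c * K b a c d); last first.
    apply: eq_bigr => c _; rewrite mxE; apply: eq_bigr => b _.
    rewrite PsiE mulr_suml; apply: eq_bigr => d _.
    by rewrite mulr_suml; apply: eq_bigr => a _; rewrite Ksym; ring.
  under eq_bigr => d _.
    rewrite exchange_big; under eq_bigr => b _ do rewrite exchange_big.
    rewrite exchange_big; over.
  rewrite exchange_big; apply: eq_bigr => c _ /=.
  by rewrite exchange_big.
(* [FPsi] at the identity reads S^2 = Psi(S) S + S Psi(S); its (a, d) entry carries the factor s d +
   s a, which is nonzero. *)
have Psi_S : Psi S = 2^-1 *: S.
  apply/matrixP => a d; have /matrixP/(_ a d) := FPsi 1%:M.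
  rewrite F1 !mulmx1 mul1mx mul_mx_rdiag [RHS]mxE mul_mx_rdiag mul_rdiag_mx -!/(z _).
  rewrite [Psi S a d * z d]mulrC -mulrDl [in X in _ -> X]mxE rdiagE -/(z a) => SS.
  have zz : z d + z a != 0.
    rewrite -rmorphD -(rmorph0 (real_complex R)) (inj_eq (@complexI _)).
    by rewrite gt_eqF// addr_gt0.
  apply: (mulfI zz); rewrite -SS.
  case: (a =P d) => [->|_]; rewrite ?mulr1n ?mulr0n ?mul0r ?mulr0//.
  by field.
exists #|{: 'I_n * 'I_n}|, V => X Xh.
have trPsi (A Y B : 'M[C]_n) : \tr (A *m Psi Y *m B) =
    \sum_k \tr (A *m (V k)^t* *m Y *m V k *m B).
  rewrite mulmx_sumr mulmx_suml raddf_sum; apply: eq_bigr => k _ /=.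
  by rewrite !mulmxA.
clearbody Psi.
have sum4 (f g h e : 'I_#|{: 'I_n * 'I_n}| -> C) :
    \sum_k (f k - g k - h k + e k) =
    \sum_k f k - \sum_k g k - \sum_k h k + \sum_k e k.
  by rewrite big_split !sumrB.
have -> : \sum_k \tr ((V k *m X - X *m V k)^t* *m S *m (V k *m X - X *m V k) *m S) =
    \tr (X *m Psi S *m (X *m S)) - \tr (X *m Psi (S *m X) *m S)
    - \tr (1%:M *m Psi (X *m S) *m (X *m S)) + \tr (1%:M *m Psi (X *m S *m X) *m S).
  have comm k := mxtrace_commutator (V k) S Xh.
  apply: etrans (etrans (eq_bigr _ (fun k _ => comm k)) (sum4 _ _ _ _)) _.
  by congr (_ - _ - _ + _); symmetry; exact: trPsi.
(* The first and last terms are each half the trace of X S X S, the last one after [Psi_sym]; the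
   two middle ones add up to the trace of X S F(X) S. *)
rewrite !mul1mx -(Psi_sym S) (mxtrace_mulC (Psi (X *m S))) -(mulmxA X S).
have trF : \tr (X *m S *m F X *m S) =
    \tr (X *m Psi (S *m X) *m S) + \tr (X *m S *m Psi (X *m S)).
  rewrite -(mulmxA X S) -(mulmxA X (S *m F X)) FPsi mulmxDr raddfD /=.
  by congr (_ + _); rewrite mulmxA.
have half (A B : 'M[C]_n) : \tr (A *m Psi S *m B) = \tr (A *m S *m B) / 2.
  by rewrite Psi_S -scalemxAr -scalemxAl mxtraceZ mulrC.
have tr1 := half X (X *m S); rewrite (mulmxA (X *m S)) in tr1.
have tr4 := half (X *m (S *m X)) 1%:M; rewrite !mulmx1 in tr4.
rewrite trF tr1 tr4 (mulmxA X S X).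
move: (\tr (X *m S *m X *m S)) (\tr (X *m S *m Psi _)) (\tr (X *m Psi _ *m S)).
by move=> t u v; field.
Qed.

End CommutatorForm.

Lemma mxtrace_weighted {K : numClosedFieldType} n (A B : 'M[K]_n) (z : 'I_n -> K) :
  \tr (A^t* *m diag_mx (\row_i z i) *m B *m diag_mx (\row_i z i)) =
  \sum_a \sum_b z a * z b * ((A a b)^* * B a b).
Proof.
rewrite exchange_big; apply: eq_bigr => b _ /=.
rewrite mul_mx_diag mxE [X in X * _]mxE big_distrl; apply: eq_bigr => a _ /=.
by rewrite mul_mx_diag !mxE; ring.
Qed.

Lemma mxtrace_conj {K : numClosedFieldType} n (U X Y S : 'M[K]_n) :
  \tr (X^t* *m (U^t* *m S *m U) *m Y *m (U^t* *m S *m U)) =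
  \tr ((U *m X *m U^t*)^t* *m S *m (U *m Y *m U^t*) *m S).
Proof.
by rewrite !trmxCM trmxCK mulmxA mxtrace_mulC !mulmxA.
Qed.

(** * Coordinates in which the density matrix is diagonal *)

Section KmsCoordinates.
Context {R : realType} {n : nat}.
Local Notation C := R[i].
Implicit Types (D X Y Z : 'M[C]_n).

(** [s] lists the square roots of the eigenvalues of [D], so that the KMS norm weights the (a, b)
    entry by s a s b and the GNS norm by s a ^+ 2. *)
Definition kms_frame D (U : 'M[C]_n) (s : 'I_n -> R) : Prop :=
  [/\ U *m U^t* = 1%:M, U^t* *m U = 1%:M, forall i, 0 < s i,
      mxsqrt D = U^t* *m rdiag s *m U &
      D = U^t* *m rdiag (fun i => s i ^+ 2) *m U].

Lemma pdmx_psd D : pdmx D -> psdmx D.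
Proof.
move=> D0 v; have [->|v0] := eqVneq v 0; last exact/ltW/D0.
by rewrite mulmx0 mxE.
Qed.

Lemma kms_frame_exists D : pdmx D -> exists U s, kms_frame D U s.
Proof.
move=> Dpd; have D0 := pdmx_psd Dpd.
have [d _ Dsp] := hermitian_spectral (psdmx_hermitian D0).
have [UU UU'] := (spectralmx_adjK D, spectralmxK D).
move: (spectralmx D) UU UU' Dsp => U UU UU' Dsp.
have d0 i : 0 < d i.
  have : U^t* *m delta_mx i 0 != 0 :> 'cV_n.
    apply/eqP => /(congr1 (mulmx U)); rewrite mulmxA UU mul1mx mulmx0.
    by move=> /matrixP/(_ i 0)/eqP; rewrite !mxE !eqxx oner_eq0.
  move=> /Dpd; rewrite {1}Dsp trmxCM trmxCK trmxC_delta.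
  rewrite !mulmxA -(mulmxA _ U) UU mulmx1 -(mulmxA _ U) UU mulmx1.
  by rewrite -rowE -colE !mxE eqxx mulr1n ltcR.
have dE : (fun i => Num.sqrt (d i) ^+ 2) = d.
  by apply/funext => i; rewrite sqr_sqrtr// ltW.
exists U, (fun i => Num.sqrt (d i)); split; [exact: UU | exact: UU' | | |].
- by move=> i; rewrite sqrtr_gt0.
- have SS := mxsqrtK D0; rewrite [in RHS]Dsp in SS.
  apply: psd_root_uniq; first exact: mxsqrt_psd.
    by apply: psd_conj_rdiag => i; rewrite sqrtr_ge0.
  by rewrite SS (conj_unitaryM _ _ UU) rdiagM -[in LHS]dE;
     congr (_ *m rdiag _ *m _); apply/funext => i; rewrite expr2.
- by rewrite dE.
Qed.

Lemma kmsDr D X Y Z : kms D X (Y + Z) = kms D X Y + kms D X Z.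
Proof. by rewrite /kms mulmxDr mulmxDl raddfD. Qed.

Lemma kmsZr D X Y a : kms D X (a *: Y) = a * kms D X Y.
Proof. by rewrite /kms -scalemxAr -scalemxAl mxtraceZ. Qed.

Lemma kmsNr D X Y : kms D X (- Y) = - kms D X Y.
Proof. by rewrite -scaleN1r kmsZr mulN1r. Qed.

Lemma kmsBr D X Y Z : kms D X (Y - Z) = kms D X Y - kms D X Z.
Proof. by rewrite kmsDr kmsNr. Qed.

Lemma kms_sumr D X (I : finType) (Y : I -> 'M[C]_n) :
  kms D X (\sum_i Y i) = \sum_i kms D X (Y i).
Proof. by rewrite /kms mulmx_sumr mulmx_suml raddf_sum. Qed.

Lemma kms_conj D X Y : psdmx D -> (kms D X Y)^* = kms D Y X.
Proof.
move=> /mxsqrt_psd/psdmx_hermitian; rewrite /kms; move: (mxsqrt D) => S Sh.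
rewrite -mxtrace_trmxC !trmxCM trmxCK Sh.
by rewrite mxtrace_mulC !mulmxA.
Qed.

Section Frame.
Variables (D U : 'M[C]_n) (s : 'I_n -> R).
Hypothesis DU : kms_frame D U s.

Definition incoord X := U *m X *m U^t*.

Lemma incoordK X : U^t* *m incoord X *m U = X.
Proof.
have [UU UU' _ _ _] := DU.
by rewrite /incoord !mulmxA UU' mul1mx -mulmxA UU' mulmx1.
Qed.

Lemma outcoordK X : incoord (U^t* *m X *m U) = X.
Proof.
have [UU UU' _ _ _] := DU.
by rewrite /incoord !mulmxA UU mul1mx -mulmxA UU mulmx1.
Qed.

Lemma incoord_trmxC X : incoord (X^t*) = (incoord X)^t*.
Proof. by rewrite /incoord !trmxCM trmxCK mulmxA. Qed.

Lemma incoordM X Y : incoord (X *m Y) = incoord X *m incoord Y.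
Proof.
have [UU UU' _ _ _] := DU.
by rewrite /incoord !mulmxA -(mulmxA _ _ U) UU' mulmx1.
Qed.

Lemma hs2_incoord X : hs2 (incoord X) = hs2 X.
Proof.
have [UU UU' _ _ _] := DU.
by rewrite /incoord hs2_unitaryr ?trmxCK// hs2_unitaryl.
Qed.

Lemma kms_incoord X Y : kms D X Y =
  \tr ((incoord X)^t* *m rdiag s *m incoord Y *m rdiag s).
Proof.
have [_ _ _ SE _] := DU.
by rewrite /kms SE mxtrace_conj.
Qed.

Lemma kms_incoordE X Y : kms D X Y =
  \sum_a \sum_b (s a * s b)%:C * ((incoord X a b)^* * incoord Y a b).
Proof.
rewrite kms_incoord mxtrace_weighted; apply: eq_bigr => a _; apply: eq_bigr => b _.
by rewrite rmorphM.
Qed.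

Lemma kms_normE X : kms D X X = (\sum_a \sum_b s a * s b * nsq (incoord X a b))%:C.
Proof.
rewrite kms_incoordE rmorph_sum; apply: eq_bigr => a _ /=.
by rewrite rmorph_sum; apply: eq_bigr => b _ /=; rewrite -nsqE -rmorphM.
Qed.

Lemma commutator_form (F : {linear 'M[C]_n -> 'M[C]_n}) :
  completely_positive F -> F 1%:M = 1%:M ->
  (forall X Y, kms D X (F Y) = kms D (F X) Y) ->
  exists N (V : 'I_N -> 'M[C]_n), forall X, X^t* = X ->
    kms D X X - kms D X (F X) =
    \sum_k kms D (V k *m X - X *m V k) (V k *m X - X *m V k).
Proof.
move=> Fcp F1 Fsym; have [UU UU' s0 _ _] := DU.
pose F' : {linear 'M[C]_n -> 'M[C]_n} := conj_map U F.
have F'E X : F' (incoord X) = incoord (F X).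
  by rewrite /F' /= /conj_map incoordK.
have F'1 : F' 1%:M = 1%:M.
  have -> : 1%:M = incoord 1%:M by rewrite /incoord mulmx1.
  by rewrite F'E F1.
have F'psd : psdmx (choi F') by exact: choi_conj_psd.
clearbody F'.
(* The diagonal case has no adjoint on the left argument: [X] is written as an adjoint, and [F]
   commutes with adjoints by [cp_trmxC]. *)
have F'sym X Y : \tr (X *m rdiag s *m F' Y *m rdiag s) =
    \tr (F' X *m rdiag s *m Y *m rdiag s).
  have [Y' ->] : exists Y', Y = incoord Y' by exists (U^t* *m Y *m U); rewrite outcoordK.
  have [X' XE] : exists X', X^t* = incoord X'.
    by exists (U^t* *m X^t* *m U); exact/esym/outcoordK.
  have F'X : F' X = (incoord (F X'))^t*.
    rewrite -incoord_trmxC -cp_trmxC// -F'E; congr (F' _).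
    by rewrite incoord_trmxC -XE trmxCK.
  have := Fsym X' Y'; rewrite (kms_incoord X') (kms_incoord (F X')) -XE trmxCK.
  by rewrite -F'X F'E.
have [N [V VE]] := commutator_form_diag s0 F'psd F'1 F'sym.
exists N, (fun k => U^t* *m V k *m U) => X Xh.
have Xch : (incoord X)^t* = incoord X by rewrite -incoord_trmxC Xh.
have := VE _ Xch; rewrite F'E.
rewrite !kms_incoord Xch => ->; apply: eq_bigr => k _; rewrite kms_incoord.
suff -> : incoord (U^t* *m V k *m U *m X - X *m (U^t* *m V k *m U)) =
    V k *m incoord X - incoord X *m V k by [].
transitivity (incoord (U^t* *m V k *m U *m X) - incoord (X *m (U^t* *m V k *m U))).
  by rewrite /incoord mulmxBr mulmxBl.
by rewrite (incoordM _ X) (incoordM X) outcoordK.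
Qed.

(** In the basis [G] the commutator of V_j with X has entries (V_j)_ik (x k - x i), so its
    Hilbert-Schmidt norm is an edge energy with weights the sums over j of |(V_j)_ik|^2; the KMS
    norm differs by factors s a s b in [m, M]. The weights are fixed before [x]: one graph serves
    all functions of the same eigenbasis. *)
Lemma dirichlet_weights (F : {linear 'M[C]_n -> 'M[C]_n}) (G : 'M[C]_n) (m M : R) :
  completely_positive F -> F 1%:M = 1%:M ->
  (forall X Y, kms D X (F Y) = kms D (F X) Y) ->
  G *m G^t* = 1%:M -> 0 <= m -> (forall a, m <= s a ^+ 2 <= M) ->
  exists2 w : 'I_n -> 'I_n -> R, forall i k, 0 <= w i k &
    forall (x : 'I_n -> R) X q, X = G^t* *m rdiag x *m G ->
      q = \sum_i \sum_k w i k * (x i - x k) ^+ 2 ->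
      m * q <= complex.Re (kms D X X - kms D X (F X)) <= M * q.
Proof.
move=> Fcp F1 Fsym GG m0 mM; have [UU UU' s0 _ _] := DU.
have [N [V VE]] := commutator_form Fcp F1 Fsym.
exists (fun i k => \sum_j nsq ((G *m V j *m G^t*) i k)).
  by move=> i k; apply: sumr_ge0 => j _; exact: nsq_ge0.
move=> x X q XE qx.
have Xh : X^t* = X by rewrite XE !trmxCM trmxCK trmxC_rdiag mulmxA.
pose Z j := V j *m X - X *m V j.
have qE : q = \sum_j hs2 (Z j).
  rewrite qx; under eq_bigr => i _.
    under eq_bigr => k _ do rewrite mulr_suml.
    rewrite exchange_big; over.
  rewrite exchange_big; apply: eq_bigr => j _ /=.
  rewrite -(hs2_unitaryl (Z j) (mulmx1C GG)) -(@hs2_unitaryr _ _ _ (G^t*)); last first.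
    by rewrite trmxCK (mulmx1C GG).
  rewrite /hs2; apply: eq_bigr => i _; apply: eq_bigr => k _.
  have -> : G *m Z j *m G^t* =
      G *m V j *m G^t* *m rdiag x - rdiag x *m (G *m V j *m G^t*).
    rewrite /Z mulmxBr mulmxBl XE; congr (_ - _).
      by rewrite !mulmxA -(mulmxA _ G (G^t*)) GG mulmx1.
    by rewrite !mulmxA GG mul1mx.
  move: (G *m V j *m G^t*) => W; rewrite [in RHS]mxE mul_mx_rdiag.
  rewrite [X in _ = nsq (_ + X)]mxE mul_rdiag_mx.
  by rewrite [(x i)%:C * _]mulrC -mulrBr -rmorphB nsqM nsq_real -sqrrN opprB.
have kmsq : complex.Re (kms D X X - kms D X (F X)) =
    \sum_j \sum_a \sum_b s a * s b * nsq (incoord (Z j) a b).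
  rewrite VE//; apply: (@complexI R); rewrite -real_complexK; last first.
    rewrite rmorph_sum; apply: eq_bigr => j _ /=.
    by rewrite kms_normE conjC_real.
  by rewrite rmorph_sum; apply: eq_bigr => j _; rewrite kms_normE.
rewrite kmsq qE !mulr_sumr.
have sab a b : m <= s a * s b <= M.
  have [ma Ma] := andP (mM a); have [mb Mb] := andP (mM b).
  have [sab|/ltW sab] := leP (s a) (s b); apply/andP; split.
  - by apply: le_trans ma _; rewrite expr2 ler_wpM2l// ltW.
  - by apply: le_trans Mb; rewrite expr2 ler_wpM2r// ltW.
  - by apply: le_trans mb _; rewrite expr2 ler_wpM2r// ltW.
  - by apply: le_trans Ma; rewrite expr2 ler_wpM2l// ltW.
apply/andP; split; apply: ler_sum => j _; rewrite -(hs2_incoord (Z j)) mulr_sumr.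
  apply: ler_sum => a _; rewrite mulr_sumr; apply: ler_sum => b _.
  by have [? _] := andP (sab a b); rewrite ler_wpM2r ?nsq_ge0.
apply: ler_sum => a _; rewrite mulr_sumr; apply: ler_sum => b _.
by have [_ ?] := andP (sab a b); rewrite ler_wpM2r ?nsq_ge0.
Qed.

End Frame.
End KmsCoordinates.

(** * Cheeger inequality for weighted graphs *)

Section CheegerCombinatorics.
Context {R : realType}.

(** By the Lagrange identity the defect is half a weighted sum of squares. *)
Lemma weighted_CauchySchwarz (I : finType) (w a b : I -> R) : (forall i, 0 <= w i) ->
  (\sum_i w i * (a i * b i)) ^+ 2 <=
  (\sum_i w i * a i ^+ 2) * (\sum_i w i * b i ^+ 2).
Proof.
move=> w0.
have : 0 <= \sum_i \sum_j w i * w j * (a i * b j - a j * b i) ^+ 2.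
  by do 2!apply: sumr_ge0 => ? _; rewrite mulr_ge0 ?sqr_ge0 ?mulr_ge0.
pose A := \sum_i w i * a i ^+ 2; pose B := \sum_i w i * b i ^+ 2.
pose X := \sum_i w i * (a i * b i).
suff -> : \sum_i \sum_j w i * w j * (a i * b j - a j * b i) ^+ 2 =
    (A * B - X ^+ 2) *+ 2.
  by rewrite pmulrn_lge0// subr_ge0.
have -> : \sum_i \sum_j w i * w j * (a i * b j - a j * b i) ^+ 2 =
    A * B + B * A - X * X *+ 2.
  rewrite /A /B /X !big_distrlr/= -big_split -sumrMnl -sumrB; apply: eq_bigr => i _ /=.
  rewrite -big_split -sumrMnl -sumrB; apply: eq_bigr => j _ /=.
  by ring.
by ring.
Qed.

Definition indicator (T : finType) (A : {set T}) (i : T) : R := (i \in A)%:R.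

(** Induction on the size of the support: the least positive value times the indicator of the
    support is peeled off. The sets obtained are nested, so for fixed i and k all the differences of
    indicators have the same sign and their absolute values add up; this is a finite coarea
    formula. *)
Lemma layer_cake (T : finType) (g : T -> R) : (forall i, 0 <= g i) ->
  exists s : seq (R * {set T}),
    [/\ forall p, p \in s -> [/\ 0 <= p.1, p.2 != finset.set0 &
          {subset p.2 <= [pred i | 0 < g i]}],
        forall i, g i = \sum_(p <- s) p.1 * indicator p.2 i &
        forall i k, `|g i - g k| =
          \sum_(p <- s) p.1 * `|indicator p.2 i - indicator p.2 k|].
Proof.
have [N] := ubnP #|[pred i | 0 < g i]|; elim: N g => // N IH g; rewrite ltnS => gN g0.
have [B0|[i0 i0B]] := set_0Vmem [set i | 0 < g i]%SET.
  have gz i : g i = 0.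
    apply/eqP; rewrite eq_le g0 andbT leNgt; apply/negP => gi.
    have : i \in [set i | 0 < g i]%SET by rewrite finset.in_set.
    by rewrite B0 finset.in_set0.
  by exists [::]; split => // [i|i k]; rewrite big_nil !gz// subrr normr0.
pose B := [set i | 0 < g i]%SET.
case: (arg_minP g i0B) => b bB' bmin; have bB : b \in B := bB'.
pose g' i := g i - g b * indicator B i.
have gB i : i \notin B -> g i = 0.
  by rewrite finset.in_set -leNgt => gi; apply/eqP; rewrite eq_le gi g0.
have gb0 : 0 < g b by move: bB; rewrite finset.in_set.
have g'0 i : 0 <= g' i.
  rewrite /g' /indicator; case: (boolP (i \in B)) => iB; rewrite ?mulr1 ?mulr0.
    by rewrite subr_ge0 bmin.
  by rewrite subr0.
have sub i : 0 < g' i -> 0 < g i.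
  by move=> h; apply: lt_le_trans h _; rewrite /g' gerBl mulr_ge0 ?(ltW gb0) ?ler0n.
have [|s [s1 s2 s3]] := IH g' _ g'0.
  apply: leq_trans gN; apply: proper_card; apply/properP; split.
    by apply/fintype.subsetP => i; exact: sub.
  exists b; first by move: bB; rewrite finset.in_set inE.
  by rewrite inE /g' /indicator bB mulr1 subrr ltxx.
have g'z i : i \notin B -> g' i = 0.
  by move=> iB; rewrite /g' /indicator (negbTE iB) mulr0 subr0 gB.
exists ((g b, B) :: s); split => [p|i|i k].
- rewrite in_cons => /orP[/eqP->|ps]; last first.
    by have [? ? ps3] := s1 _ ps; split => // i /ps3; exact: sub.
  split => /=; first exact: ltW.
  - by apply/set0Pn; exists b.
  - by move=> i; rewrite finset.in_set inE.
- by rewrite big_cons -s2 /g' /= addrC subrK.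
- rewrite big_cons -s3 /=.
  have gE j : g j = g b * indicator B j + g' j by rewrite /g' addrC subrK.
  rewrite [in LHS](gE i) [in LHS](gE k) /indicator.
  case: (boolP (i \in B)) => iB; case: (boolP (k \in B)) => kB;
    rewrite ?(g'z _ iB) ?(g'z _ kB) ?mulr1 ?mulr0 ?addr0 ?subrr ?normr0 ?mulr0 ?add0r
      ?subr0 ?sub0r ?normrN ?normr1 ?mulr1//.
  + by congr (`|_|); ring.
  + by rewrite (ger0_norm (g'0 _)) ger0_norm// addr_ge0 ?g'0 ?(ltW gb0).
  + by rewrite (ger0_norm (g'0 _)) ger0_norm// addr_ge0 ?g'0 ?(ltW gb0).
Qed.

Definition edge_energy n (w : 'I_n -> 'I_n -> R) (x : 'I_n -> R) : R :=
  \sum_i \sum_k w i k * (x i - x k) ^+ 2.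

Lemma edge_energy_ge0 n (w : 'I_n -> 'I_n -> R) x :
  (forall i k, 0 <= w i k) -> 0 <= edge_energy w x.
Proof.
by move=> w0; do 2!apply: sumr_ge0 => ? _; rewrite mulr_ge0 ?sqr_ge0.
Qed.

Lemma edge_energy_indicator n (w : 'I_n -> 'I_n -> R) (A : {set 'I_n}) :
  edge_energy w (indicator A) =
  \sum_i \sum_k w i k * `|indicator A i - indicator A k|.
Proof.
apply: eq_bigr => i _; apply: eq_bigr => k _; congr (_ * _); rewrite /indicator.
by case: (i \in A); case: (k \in A);
  rewrite ?subrr ?subr0 ?sub0r ?normrN ?normr1 ?normr0 ?expr0n ?sqrrN ?expr1n.
Qed.

(** The energy of a singleton is the degree of the vertex, here with both orientations counted.
    Writing degrees as energies lets them be replaced later by Dirichlet forms of projections. *)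
Lemma edge_energy_singletons n (w : 'I_n -> 'I_n -> R) (y : 'I_n -> R) :
  \sum_j y j ^+ 2 * edge_energy w (indicator [set j]%SET) =
  \sum_i \sum_k w i k * ((i != k)%:R * (y i ^+ 2 + y k ^+ 2)).
Proof.
under eq_bigr => j _.
  rewrite /edge_energy mulr_sumr; under eq_bigr => i _ do rewrite mulr_sumr.
  over.
rewrite exchange_big; apply: eq_bigr => i _ /=.
rewrite exchange_big; apply: eq_bigr => k _ /=.
transitivity (w i k * \sum_j y j ^+ 2 * ((i == j)%:R - (k == j)%:R) ^+ 2).
  by rewrite mulr_sumr; apply: eq_bigr => j _; rewrite /indicator !finset.in_set1 mulrCA.
congr (_ * _); have [->|ik] := eqVneq i k.
  by rewrite mul0r big1// => j _; rewrite subrr expr0n mulr0.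
have ki : k != i by rewrite eq_sym.
rewrite (bigD1 i)//= (bigD1 k)//= big1 => [|j /andP[ji jk]].
  rewrite !eqxx (negbTE ki) (negbTE ik).
  by rewrite subr0 sub0r sqrrN expr1n !mulr1 addr0 mul1r.
by rewrite (eq_sym i) (negbTE ji) (eq_sym k) (negbTE jk) subrr expr0n mulr0.
Qed.

Lemma sqr_max_parts (a : R) : Num.max a 0 ^+ 2 + Num.max (- a) 0 ^+ 2 = a ^+ 2.
Proof.
have [a0|/ltW a0] := leP 0 a.
  by rewrite max_r ?oppr_le0// expr0n addr0.
by rewrite max_l ?oppr_ge0// expr0n add0r sqrrN.
Qed.

(** Equal signs give a difference of two squares; for opposite signs the left side is a^2 + b^2 and
    the right side (|a| + |b|)^2. *)
Lemma dist_sqr_max_parts (a b : R) :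
  `|Num.max a 0 ^+ 2 - Num.max b 0 ^+ 2| +
  `|Num.max (- a) 0 ^+ 2 - Num.max (- b) 0 ^+ 2| <= `|a - b| * (`|a| + `|b|).
Proof.
have [a0|/ltW a0] := leP 0 a; have [b0|/ltW b0] := leP 0 b.
- rewrite !max_r ?oppr_le0// expr0n subrr normr0 addr0.
  by rewrite subr_sqr normrM (ger0_norm a0) (ger0_norm b0) (@ger0_norm _ (a + b)) ?addr_ge0.
- rewrite (@max_r _ _ (- a)) ?oppr_le0//.
  rewrite (@max_l _ _ (- b)) ?oppr_ge0// expr0n subr0 sub0r normrN sqrrN.
  rewrite !(ger0_norm (sqr_ge0 _)) (ger0_norm a0) (ler0_norm b0).
  by rewrite ger0_norm ?subr_ge0 ?(le_trans b0 a0)//; nra.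
- rewrite (@max_l _ _ (- a)) ?oppr_ge0//.
  rewrite (@max_r _ _ (- b)) ?oppr_le0// expr0n subr0 sub0r normrN sqrrN.
  rewrite !(ger0_norm (sqr_ge0 _)) (ler0_norm a0) (ger0_norm b0).
  by rewrite ler0_norm ?subr_le0 ?(le_trans a0 b0)//; nra.
- rewrite !max_l ?oppr_ge0// expr0n subrr normr0 add0r.
  rewrite !sqrrN subr_sqr normrM (ler0_norm a0) (ler0_norm b0).
  by rewrite (@ler0_norm _ (a + b)) ?opprD// -oppr_ge0 opprD addr_ge0 ?oppr_ge0.
Qed.

(* The thresholds are those of [y |y|]; Cauchy-Schwarz applied to
   [| y_i |y_i| - y_k |y_k| | <= |y_i - y_k| (|y_i| + |y_k|)]. *)
Lemma cheeger_levels n (y : 'I_n -> R) : exists s : seq (R * {set 'I_n}),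
  [/\ forall p, p \in s -> [/\ 0 <= p.1, p.2 != finset.set0 &
        {subset p.2 <= [pred i | 0 < y i]} \/ {subset p.2 <= [pred i | y i < 0]}],
      forall i, y i ^+ 2 = \sum_(p <- s) p.1 * indicator p.2 i &
      forall w, (forall i k, 0 <= w i k) ->
        (\sum_(p <- s) p.1 * edge_energy w (indicator p.2)) ^+ 2 <=
        edge_energy w y *
          (2 * \sum_j y j ^+ 2 * edge_energy w (indicator [set j]%SET))].
Proof.
(* The two signs are layered separately, so that no level set meets both. *)
pose gp i := Num.max (y i) 0 ^+ 2; pose gn i := Num.max (- y i) 0 ^+ 2.
have [sp [sp1 sp2 sp3]] := layer_cake (fun i => sqr_ge0 (Num.max (y i) 0)).
have [sn [sn1 sn2 sn3]] := layer_cake (fun i => sqr_ge0 (Num.max (- y i) 0)).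
(* The levels depend on [y] alone, so a single family serves every weight [w]. *)
exists (sp ++ sn); split => [p|i|w w0].
- rewrite mem_cat => /orP[/sp1|/sn1] [p0 pn0 psub]; split => //; [left|right] => i /psub.
    rewrite !inE /Num.max; case: ifP => [_|/negbT]; rewrite ?expr0n ?ltxx//.
    rewrite -leNgt => yi h; rewrite lt_neqAle yi andbT; apply/eqP => y0.
    by move: h; rewrite -y0 expr0n ltxx.
  rewrite !inE /Num.max; case: ifP => [_|/negbT]; rewrite ?expr0n ?ltxx//.
  rewrite -leNgt oppr_ge0 => yi h; rewrite lt_neqAle yi andbT; apply/eqP => y0.
  by move: h; rewrite y0 oppr0 expr0n ltxx.
- by rewrite big_cat -sp2 -sn2 /= sqr_max_parts.
- have absE i k : \sum_(p <- sp ++ sn) p.1 * `|indicator p.2 i - indicator p.2 k| <=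
      `|y i - y k| * ((i != k)%:R * (`|y i| + `|y k|)).
    rewrite big_cat -sp3 -sn3 /=.
    have [->|ik] := eqVneq i k; first by rewrite !subrr normr0 mul0r addr0.
    by rewrite mul1r dist_sqr_max_parts.
  set s := sp ++ sn in absE *.
  have s0 p : p \in s -> 0 <= p.1 by rewrite mem_cat => /orP[/sp1|/sn1] [].
  pose W (ik : 'I_n * 'I_n) := w ik.1 ik.2.
  pose a (ik : 'I_n * 'I_n) := `|y ik.1 - y ik.2|.
  pose b (ik : 'I_n * 'I_n) := (ik.1 != ik.2)%:R * (`|y ik.1| + `|y ik.2|).
  have W0 ik : 0 <= W ik by exact: w0.
  have left_ge0 : 0 <= \sum_(p <- s) p.1 * edge_energy w (indicator p.2).
    by rewrite big_seq; apply: sumr_ge0 => p /s0 p0; rewrite mulr_ge0 ?edge_energy_ge0.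
  have left_le : \sum_(p <- s) p.1 * edge_energy w (indicator p.2) <=
      \sum_ik W ik * (a ik * b ik).
    rewrite sum_pairE.
    have -> : \sum_(p <- s) p.1 * edge_energy w (indicator p.2) =
        \sum_i \sum_k w i k *
          \sum_(p <- s) p.1 * `|indicator p.2 i - indicator p.2 k|.
      under eq_bigr => p _.
        rewrite edge_energy_indicator mulr_sumr.
        under eq_bigr => i _ do rewrite mulr_sumr.
        over.
      rewrite exchange_big; apply: eq_bigr => i _ /=.
      rewrite exchange_big; apply: eq_bigr => k _ /=.
      by rewrite mulr_sumr; apply: eq_bigr => p _; rewrite mulrCA.
    apply: ler_sum => i _; apply: ler_sum => k _.
    by rewrite /W /a /b /= ler_wpM2l.
  apply: le_trans (_ : _ <= (\sum_ik W ik * (a ik * b ik)) ^+ 2) _.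
    by rewrite lerXn2r// nnegrE// (le_trans left_ge0).
  apply: le_trans (weighted_CauchySchwarz _ _ W0) _.
  have -> : \sum_ik W ik * a ik ^+ 2 = edge_energy w y.
    rewrite sum_pairE; apply: eq_bigr => i _; apply: eq_bigr => k _.
    by rewrite /W /a /= real_normK ?num_real.
  rewrite ler_wpM2l ?edge_energy_ge0// edge_energy_singletons mulr_sumr sum_pairE.
  apply: ler_sum => i _; rewrite mulr_sumr; apply: ler_sum => k _.
  rewrite [leRHS]mulrCA /W /b /= ler_wpM2l//.
  case: eqP => _ /=; first by rewrite !mul0r expr0n mulr0.
  (* The constant 2 is that of (u + v)^2 <= 2 (u^2 + v^2). *)
  rewrite !mul1r -(real_normK (num_real (y i))) -(real_normK (num_real (y k))).
  move: `|y i| `|y k| => u v; rewrite -subr_ge0.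
  have -> : 2 * (u ^+ 2 + v ^+ 2) - (u + v) ^+ 2 = (u - v) ^+ 2 by ring.
  exact: sqr_ge0.
Qed.

(** The median is the largest value x j with mass at most 1/2 strictly below it. If x k is the next
    value, the mass strictly below x k exceeds 1/2, and the complementary set is {x > x j}. *)
Lemma median_exists n (x p : 'I_n -> R) : (forall i, 0 <= p i) ->
  \sum_i p i = 1 -> exists m,
    \sum_(i | m < x i) p i <= 2^-1 /\ \sum_(i | x i < m) p i <= 2^-1.
Proof.
case: n x p => [|n] x p p0 p1.
  by move: p1 => /eqP; rewrite big_ord0 eq_sym oner_eq0.
pose P j := \sum_(i | x i < x j) p i <= 2^-1.
have [jmin _ jminP] := @arg_minP _ _ _ ord0 xpredT x isT.
have Pmin : P jmin.
  by rewrite /P big_pred0 ?invr_ge0 ?ler0n// => i; rewrite ltNge jminP.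
case: (arg_maxP x Pmin) => j Pj jmax.
exists (x j); split => //.
case: (pickP [pred i | x j < x i]) => [k0 k0P|none]; last first.
  by rewrite big_pred0 ?invr_ge0 ?ler0n.
case: (arg_minP x k0P) => k kP kmin.
have nPk : ~~ P k.
  by apply/negP => Pk; have := lt_le_trans kP (jmax _ Pk); rewrite ltxx.
have : \sum_(i | x i < x k) p i + \sum_(i | ~~ (x i < x k)) p i = 1.
  by rewrite -p1 [RHS](bigID (fun i => x i < x k)).
have -> : \sum_(i | ~~ (x i < x k)) p i = \sum_(i | x j < x i) p i.
  apply: eq_bigl => i; rewrite -leNgt; apply/idP/idP => [h|h].
    exact: lt_le_trans h.
  exact: kmin.
by move: nPk; rewrite /P -ltNge; lra.
Qed.

End CheegerCombinatorics.

(** * The generator as a derivative *)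

Section Modulus.
Context {R : realType}.
Implicit Types (z w : R[i]).

(** The norm of [R[i]] takes its values in [R[i]]; limits and suprema here need the modulus as an
    element of [R]. *)
Definition cmod z : R := Num.sqrt (nsq z).

Lemma cmodE z : `|z| = (cmod z)%:C.
Proof. exact: normc_def. Qed.

Lemma cmod_ge0 z : 0 <= cmod z.
Proof. exact: sqrtr_ge0. Qed.

Lemma sqr_cmod z : cmod z ^+ 2 = nsq z.
Proof. by rewrite sqr_sqrtr ?nsq_ge0. Qed.

Lemma cmodD z w : cmod (z + w) <= cmod z + cmod w.
Proof. by rewrite -lecR rmorphD/= -!cmodE ler_normD. Qed.

Lemma cmodN z : cmod (- z) = cmod z.
Proof. by rewrite /cmod nsqN. Qed.

Lemma cmodB z w : cmod (z - w) <= cmod z + cmod w.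
Proof. by rewrite -(cmodN w) cmodD. Qed.

Lemma cmodM z w : cmod (z * w) = cmod z * cmod w.
Proof. by rewrite /cmod nsqM sqrtrM ?nsq_ge0. Qed.

Lemma cmod0 : cmod 0 = 0.
Proof. by rewrite /cmod nsq0 sqrtr0. Qed.

Lemma cmod_eq0 z : (cmod z == 0) = (z == 0).
Proof. by rewrite -sqrf_eq0 sqr_cmod nsq_eq0. Qed.

Lemma cmod_real (x : R) : cmod x%:C = `|x|.
Proof. by rewrite /cmod nsq_real sqrtr_sqr. Qed.

Lemma cmod_conj z : cmod z^* = cmod z.
Proof. by rewrite /cmod nsq_conj. Qed.

Lemma cmod_sum (I : Type) (r : seq I) (f : I -> R[i]) :
  cmod (\sum_(i <- r) f i) <= \sum_(i <- r) cmod (f i).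
Proof.
elim/big_rec2: _ => [|i x y _ h]; first by rewrite cmod0.
by apply: le_trans (cmodD _ _) _; rewrite lerD2l.
Qed.

Lemma normr_Re_le z : `|complex.Re z| <= cmod z.
Proof. by rewrite -sqrtr_sqr ler_wsqrtr// lerDl sqr_ge0. Qed.

End Modulus.

(** * From the operator norm of maps to bounds on entries *)

Section OperatorNorm.
Context {R : realType} {n : nat}.
Local Notation C := R[i].
Implicit Types (A X : 'M[C]_n) (v : 'cV[C]_n).

Lemma vnormE v : vnorm v = Num.sqrt (\sum_i nsq (v i 0)).
Proof.
rewrite /vnorm; congr (Num.sqrt _).
have -> : (v^t* *m v) 0 0 = (\sum_i nsq (v i 0))%:C.
  by rewrite mxE rmorph_sum; apply: eq_bigr => i _; rewrite !mxE -nsqE.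
by [].
Qed.

Lemma vnorm_ge0 v : 0 <= vnorm v.
Proof. exact: sqrtr_ge0. Qed.

Lemma cmod_le_vnorm v i : cmod (v i 0) <= vnorm v.
Proof.
rewrite vnormE ler_wsqrtr// (bigD1 i)//= lerDl.
by apply: sumr_ge0 => j _; exact: nsq_ge0.
Qed.

Lemma vnorm_le v M : 0 <= M -> (forall i, cmod (v i 0) <= M) -> vnorm v <= n%:R * M.
Proof.
move=> M0 vM; rewrite vnormE -[leRHS]ger0_norm ?mulr_ge0// -sqrtr_sqr ler_wsqrtr//.
apply: le_trans (_ : _ <= \sum_(i < n) M ^+ 2) _.
  by apply: ler_sum => i _; rewrite -sqr_cmod lerXn2r ?nnegrE ?cmod_ge0.
rewrite sumr_const card_ord exprMn -[leLHS]mulr_natl ler_wpM2r ?sqr_ge0//.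
by rewrite -natrX ler_nat; case: (n) => // k; rewrite leq_pmulr.
Qed.

Lemma vnorm_gt0 v : v != 0 -> 0 < vnorm v.
Proof.
move=> v0; rewrite lt_neqAle vnorm_ge0 andbT eq_sym; apply: contra v0 => /eqP vv.
apply/eqP/matrixP => i j; rewrite ord1 mxE; apply/eqP; rewrite -cmod_eq0.
by rewrite eq_le cmod_ge0 andbT -vv cmod_le_vnorm.
Qed.

Lemma opnorm_ratio_le A M v : 0 <= M -> (forall i j, cmod (A i j) <= M) -> v != 0 ->
  vnorm (A *m v) / vnorm v <= n%:R ^+ 2 * M.
Proof.
move=> M0 AM v0; rewrite ler_pdivrMr ?vnorm_gt0// expr2 -!mulrA.
apply: vnorm_le => [|i]; first by rewrite !mulr_ge0 ?vnorm_ge0.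
rewrite mxE; apply: le_trans (cmod_sum _ _) _.
have -> : n%:R * (M * vnorm v) = \sum_(j < n) M * vnorm v.
  by rewrite sumr_const card_ord mulr_natl.
apply: ler_sum => j _; rewrite cmodM ler_pM ?cmod_ge0 ?cmod_le_vnorm//.
Qed.

Lemma entry_bound A : exists2 M, 0 <= M & forall i j, cmod (A i j) <= M.
Proof.
exists (\sum_i \sum_j cmod (A i j)).
  by do 2!apply: sumr_ge0 => ? _; exact: cmod_ge0.
move=> i j; rewrite (bigD1 i)//= (bigD1 j)//= -addrA lerDl addr_ge0//.
  by apply: sumr_ge0 => *; exact: cmod_ge0.
by do 2!apply: sumr_ge0 => ? _; exact: cmod_ge0.
Qed.

Lemma opnorm_set_ubound A :
  has_ubound [set vnorm (A *m v) / vnorm v | v in [set v : 'cV[C]_n | v != 0]].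
Proof.
have [M M0 AM] := entry_bound A.
by exists (n%:R ^+ 2 * M) => _ [v v0 <-]; exact: opnorm_ratio_le.
Qed.

Lemma opnorm_le A M : 0 <= M -> (forall i j, cmod (A i j) <= M) ->
  opnorm A <= n%:R ^+ 2 * M.
Proof.
move=> M0 AM; rewrite /opnorm.
(* For n = 0 there is no nonzero vector, and [sup] is 0 on the empty set. *)
set S := [set _ | _ in _]; have [->|/set0P S0] := eqVneq S set0.
  by rewrite sup0 mulr_ge0 ?sqr_ge0.
by apply: sup_le_ub => // _ [v v0 <-]; exact: opnorm_ratio_le.
Qed.

Lemma cmod_le_opnorm A i j : cmod (A i j) <= opnorm A.
Proof.
have e0 : (delta_mx j 0 : 'cV[C]_n) != 0.
  by apply/eqP => /matrixP/(_ j 0)/eqP; rewrite !mxE !eqxx oner_eq0.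
have e1 : vnorm (delta_mx j 0 : 'cV[C]_n) = 1.
  rewrite vnormE (bigD1 j)//= big1 => [|k kj]; rewrite mxE.
    by rewrite !eqxx addr0 -[1]/(1%:C) nsq_real expr1n sqrtr1.
  by rewrite (negbTE kj) nsq0.
apply: le_trans (_ : _ <= vnorm (A *m (delta_mx j 0 : 'cV[C]_n))) _.
  by rewrite -colE; apply: le_trans (cmod_le_vnorm _ i); rewrite mxE.
rewrite -[leLHS]divr1 -e1; apply: ub_le_sup; first exact: opnorm_set_ubound.
by exists (delta_mx j 0).
Qed.

Lemma opnorm_gt0 A : A != 0 -> 0 < opnorm A.
Proof.
move=> A0; have [i [j Aij]] : exists i j, A i j != 0.
  apply/not_existsP => h; case/negP: A0; apply/eqP/matrixP => i j; rewrite mxE.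
  by apply/eqP/negP => Aij; apply: (h i); exists j; exact/negP.
apply: lt_le_trans (cmod_le_opnorm A i j).
by rewrite lt_neqAle cmod_ge0 eq_sym cmod_eq0 Aij.
Qed.

(** A real [sup] dominates the members of a set only if the set is bounded. This predicate provides
    the bound for the maps entering [map_norm], and it is stable under the operations that build the
    exponential series. *)
Definition entrywise_bounded (G : 'M[C]_n -> 'M[C]_n) := exists2 K : R, 0 <= K &
  forall X M, (forall i j, cmod (X i j) <= M) -> forall i j, cmod (G X i j) <= K * M.

Lemma linear_entrywise_bounded (F : {linear 'M[C]_n -> 'M[C]_n}) :
  entrywise_bounded F.
Proof.
pose k a d b c := cmod (F (delta_mx b c) a d).
have k0 a d b c : 0 <= k a d b c by exact: cmod_ge0.
exists (\sum_a \sum_d \sum_b \sum_c k a d b c).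
  by do 4!apply: sumr_ge0 => ? _.
move=> X M XM a d; rewrite mx_linear_sum.
have M0 : 0 <= M by apply: le_trans (XM a d); exact: cmod_ge0.
apply: le_trans (_ : _ <= (\sum_b \sum_c k a d b c) * M) _; last first.
  rewrite ler_wpM2r// [leRHS](bigD1 a)//= [X in X + _](bigD1 d)//= -addrA lerDl.
  by rewrite addr_ge0//; do ?[apply: sumr_ge0 => ? _].
apply: le_trans (cmod_sum _ _) _; rewrite mulr_suml; apply: ler_sum => b _.
apply: le_trans (cmod_sum _ _) _; rewrite mulr_suml; apply: ler_sum => c _.
by rewrite cmodM mulrC ler_wpM2l ?cmod_ge0.
Qed.

Lemma entrywise_boundedB G H : entrywise_bounded G -> entrywise_bounded H ->
  entrywise_bounded (fun X => G X - H X).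
Proof.
move=> [K K0 GK] [K' K'0 HK]; exists (K + K'); first exact: addr_ge0.
move=> X M XM i j; rewrite !mxE mulrDl.
by apply: le_trans (cmodB _ _) _; rewrite lerD ?GK ?HK.
Qed.

Lemma entrywise_bounded_sum (r : nat) (G : nat -> 'M[C]_n -> 'M[C]_n) (c : nat -> C) :
  (forall k, entrywise_bounded (G k)) ->
  entrywise_bounded (fun X => \sum_(k < r) c k *: G k X).
Proof.
move=> Gb; elim: r => [|r [K K0 IH]].
  exists 0 => // X M XM i j; rewrite big_ord0 mxE cmod0 mul0r//.
have [K' K'0 GK] := Gb r; exists (K + cmod (c r) * K').
  by rewrite addr_ge0 ?mulr_ge0 ?cmod_ge0.
move=> X M XM i j; rewrite big_ord_recr mxE [X in _ + X]mxE mulrDl.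
apply: le_trans (cmodD _ _) _; apply: lerD; first exact: IH.
by rewrite cmodM -mulrA ler_wpM2l ?cmod_ge0// GK.
Qed.

Lemma entrywise_bounded_iter (G : 'M[C]_n -> 'M[C]_n) (K : R) :
  (forall X M, (forall i j, cmod (X i j) <= M) -> forall i j, cmod (G X i j) <= K * M) ->
  forall k X M, (forall i j, cmod (X i j) <= M) ->
    forall i j, cmod (iter k G X i j) <= K ^+ k * M.
Proof.
move=> GK; elim=> [|k IH] X M XM i j; first by rewrite expr0 mul1r XM.
by rewrite iterS exprS -mulrA; apply: GK => a b; exact: IH.
Qed.

Lemma cmod_le_map_norm (G : 'M[C]_n -> 'M[C]_n) X i j : entrywise_bounded G -> X != 0 ->
  cmod (G X i j) <= map_norm opnorm G * opnorm X.
Proof.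
move=> [K K0 GK] X0; apply: le_trans (cmod_le_opnorm _ i j) _.
rewrite -ler_pdivrMr ?opnorm_gt0//; apply: ub_le_sup; last by exists X.
exists (n%:R ^+ 2 * K) => _ [Y Y0 <-]; rewrite ler_pdivrMr ?opnorm_gt0// -mulrA.
apply: opnorm_le; first by rewrite mulr_ge0// ltW// opnorm_gt0.
by apply: GK => a b; exact: cmod_le_opnorm.
Qed.

End OperatorNorm.

Section Generator.
Context {R : realType} {n : nat}.
Local Notation C := R[i].
Variables (Phi : R -> {linear 'M[C]_n -> 'M[C]_n}) (L : {linear 'M[C]_n -> 'M[C]_n}).
Hypothesis PhiL : is_generator Phi L.

Definition exp_partial (t : R) (N : nat) (X : 'M[C]_n) : 'M[C]_n :=
  \sum_(k < N) ((- t) ^+ k / k`!%:R)%:C *: iter k L X.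

Lemma exp_partial_cvg t X i j : 0 <= t ->
  cmod ((Phi t X - exp_partial t N X) i j) @[N --> \oo] --> (0 : R).
Proof.
move=> t0; have Pb N : entrywise_bounded (fun X => Phi t X - exp_partial t N X).
  apply: entrywise_boundedB; first exact: linear_entrywise_bounded.
  apply: (entrywise_bounded_sum N (G := fun k => iter k L)
    (fun k => ((- t) ^+ k / k`!%:R)%:C)) => k.
  have [K K0 LK] := linear_entrywise_bounded L; exists (K ^+ k); first exact: exprn_ge0.
  exact: entrywise_bounded_iter.
have [->|X0] := eqVneq X 0.
  have -> : (fun N => cmod ((Phi t 0 - exp_partial t N 0) i j)) = fun=> 0.
    apply/funext => N; have [K K0 /(_ 0 0)] := Pb N.
    rewrite mulr0 => /(_ _ i j) h; apply/eqP; rewrite eq_le cmod_ge0 andbT.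
    by apply: h => a b; rewrite mxE cmod0.
  exact: cvg_cst.
pose G N (X : 'M[C]_n) := Phi t X - exp_partial t N X.
apply: (@squeeze_cvgr _ _ _ _ (fun=> 0) (fun N => map_norm opnorm (G N) * opnorm X)).
- by apply: nearW => N; rewrite cmod_ge0 /=; exact: (cmod_le_map_norm i j (Pb N) X0).
- exact: cvg_cst.
- rewrite -[X in _ --> X](mul0r (opnorm X)); apply: cvgM; last exact: cvg_cst.
  exact: PhiL.
Qed.

Lemma exp_partial_near t X i j e : 0 <= t -> 0 < e ->
  exists N, cmod ((Phi t X - exp_partial t N.+2 X) i j) < e.
Proof.
move=> t0 e0; have /cvgrPdist_lt/(_ _ e0)[N _ NP] := exp_partial_cvg X i j t0.
(* At least two terms are kept, so that those of orders 0 and 1 can be split off. *)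
exists N; have := NP N.+2 (leqW (leqnSn N)).
by rewrite /= sub0r normrN ger0_norm ?cmod_ge0.
Qed.

(** On an eigenvector the partial sums are those of the scalar exponential series. *)
Lemma semigroup_eigen t (l : R) X : 0 <= t -> L X = l%:C *: X ->
  Phi t X = (expR (- (t * l)))%:C *: X.
Proof.
move=> t0 LX.
have itE k : iter k L X = (l ^+ k)%:C *: X.
  elim: k => [|k IH]; first by rewrite expr0 scale1r.
  by rewrite iterS IH linearZ /= LX scalerA -rmorphM/= -exprSr.
have pE N : exp_partial t N X = (series (exp_coeff (- (t * l))) N)%:C *: X.
  rewrite /series /= big_mkord rmorph_sum scaler_suml; apply: eq_bigr => k _.
  rewrite itE scalerA /exp_coeff/= -rmorphM/=; congr (_%:C *: _).
  by rewrite -mulNr exprMn mulrAC.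
apply/matrixP => i j; apply/eqP; rewrite -subr_eq0 -cmod_eq0.
pose ser := series (exp_coeff (- (t * l))).
have serl : ser @ \oo --> expR (- (t * l)) by exact: is_cvg_series_exp_coeff.
rewrite eq_le cmod_ge0 andbT; apply/ler_addgt0Pr => e e0; rewrite add0r.
have e20 : 0 < e / 2 by rewrite divr_gt0.
pose M := cmod (X i j) + 1.
have M0 : 0 < M by rewrite ltr_wpDl ?cmod_ge0.
have /cvgrPdist_lt/(_ _ e20)[N1 _ NP1] := exp_partial_cvg X i j t0.
have /cvgrPdist_lt/(_ _ (divr_gt0 e20 M0))[N2 _ NP2] := serl.
have := NP1 (maxn N1 N2) (leq_maxl _ _); have := NP2 (maxn N1 N2) (leq_maxr _ _).
rewrite /= sub0r normrN (ger0_norm (cmod_ge0 _)) pE -/ser.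
move: (ser _) => a ha hb.
have -> : Phi t X i j - ((expR (- (t * l)))%:C *: X) i j =
    (Phi t X - a%:C *: X) i j + (a - expR (- (t * l)))%:C * X i j.
  by rewrite !mxE rmorphB/=; ring.
apply: le_trans (cmodD _ _) _; rewrite [leRHS]splitr lerD ?(ltW hb)//.
rewrite cmodM cmod_real distrC.
apply: le_trans (_ : _ <= e / 2 / M * M) _; last by rewrite divfK ?gt_eqF.
by rewrite ler_pM ?cmod_ge0 ?(ltW ha)// /M lerDl.
Qed.

Lemma exp_series_le (x : R) N : 0 <= x -> \sum_(k < N) x ^+ k / k`!%:R <= expR x.
Proof.
move=> x0; rewrite -(big_mkord xpredT (fun k => x ^+ k / k`!%:R)).
apply: (@nondecreasing_cvgn_le _ (series (exp_coeff x))) => [|].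
  apply/nondecreasing_seqP => k; rewrite /series/= big_nat_recr//= lerDl.
  by rewrite /exp_coeff/= divr_ge0 ?exprn_ge0.
exact: is_cvg_series_exp_coeff.
Qed.

(** With entry bounds [B] for [L] and [M] for [X], the term of order k >= 2 is at most t^k B^k M /
    k!; since t <= 1, these sum to at most t^2 e^B M. The explicit remainder reduces symmetries of
    [L] to [le0_of_linear_bound]. *)
Lemma semigroup_first_order X : exists K : R, forall t, 0 < t <= 1 ->
  forall i j, cmod ((X - Phi t X - t%:C *: L X) i j) <= K * t ^+ 2.
Proof.
have [B B0 LB] := linear_entrywise_bounded L.
have [M M0 XM] := entry_bound X.
exists (expR B * M) => t /andP[t0 t1] i j.
apply/ler_addgt0Pr => e e0; have [N Ne] := exp_partial_near X i j (ltW t0) e0.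
have -> : (X - Phi t X - t%:C *: L X) i j =
    - (\sum_(k < N) ((- t) ^+ k.+2 / k.+2`!%:R)%:C * iter k.+2 L X i j)
    - (Phi t X - exp_partial t N.+2 X) i j.
  rewrite /exp_partial 2!big_ord_recl /= !mxE expr0 expr1 !fact0 !factS !fact0 !muln1.
  rewrite !divr1 mul1r summxE.
  have -> : \sum_(k < N) ((- t) ^+ k.+2 / k.+2`!%:R)%:C * L (L (iter k L X)) i j =
    \sum_(k < N) (((- t) ^+ bump 0 (bump 0 k) / (bump 0 (bump 0 k))`!%:R)%:C *:
       iter (bump 0 (bump 0 k)) L X) i j.
    by apply: eq_bigr => k _; rewrite mxE.
  by rewrite rmorphN/=; ring.
apply: le_trans (cmodB _ _) _; rewrite lerD ?(ltW Ne)// cmodN.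
apply: le_trans (cmod_sum _ _) _.
apply: le_trans (_ : _ <= \sum_(k < N) (B ^+ k.+2 / k.+2`!%:R) * (M * t ^+ 2)) _.
  apply: ler_sum => k _; rewrite cmodM cmod_real normrM normrX normrN.
  rewrite (ger0_norm (ltW t0)) ger0_norm ?invr_ge0//.
  apply: le_trans (_ : _ <= t ^+ k.+2 / k.+2`!%:R * (B ^+ k.+2 * M)) _.
    rewrite ler_wpM2l ?divr_ge0 ?exprn_ge0 ?(ltW t0)//.
    exact: (entrywise_bounded_iter LB).
  have -> : t ^+ k.+2 / k.+2`!%:R * (B ^+ k.+2 * M) =
    (B ^+ k.+2 / k.+2`!%:R * M) * t ^+ k.+2 by ring.
  have Bk : 0 <= B ^+ k.+2 / k.+2`!%:R by rewrite divr_ge0 ?exprn_ge0.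
  have tk : t ^+ k.+2 = t ^+ k * t ^+ 2 by rewrite -exprD addn2.
  rewrite -[leLHS]mulrA ler_wpM2l// ler_wpM2l// tk.
  by rewrite ler_piMl ?sqr_ge0// exprn_ile1 ?(ltW t0).
rewrite -mulr_suml mulrA ler_wpM2r ?sqr_ge0// ler_wpM2r//.
apply: le_trans (exp_series_le N.+2 B0); rewrite 2!big_ord_recl /= addrA lerDr.
by rewrite addr_ge0// divr_ge0 ?exprn_ge0.
Qed.

Lemma le0_of_linear_bound (x K : R) : (forall t, 0 < t <= 1 -> x <= K * t) -> x <= 0.
Proof.
move=> h; apply/ler_addgt0Pr => e e0; rewrite add0r.
have K1 : 0 < `|K| + 1 by rewrite ltr_wpDl.
pose t := Num.min 1 (e / (`|K| + 1)).
have t01 : 0 < t <= 1 by rewrite lt_min ltr01 divr_gt0//= ge_min lexx.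
apply: le_trans (h t t01) _; have [t0 _] := andP t01.
apply: le_trans (_ : _ <= (`|K| + 1) * t) _.
  by rewrite ler_wpM2r ?(ltW t0)// (le_trans (ler_norm K))// lerDl.
by rewrite mulrC -ler_pdivlMr// ge_min lexx orbT.
Qed.

Lemma kms_cmod_bound (D Y : 'M[C]_n) : exists2 K : R, 0 <= K &
  forall (Z : 'M[C]_n) M, (forall i j, cmod (Z i j) <= M) -> cmod (kms D Y Z) <= K * M.
Proof.
pose A := Y^t* *m mxsqrt D; pose S := mxsqrt D.
pose k a b c := cmod (A a b) * cmod (S c a).
have k0 a b c : 0 <= k a b c by rewrite mulr_ge0 ?cmod_ge0.
exists (\sum_a \sum_c \sum_b k a b c); first by do 3!apply: sumr_ge0 => ? _.
move=> Z M ZM; rewrite /kms /mxtrace mulr_suml -/A -/S.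
apply: le_trans (cmod_sum _ _) _; apply: ler_sum => a _.
rewrite mxE mulr_suml; apply: le_trans (cmod_sum _ _) _; apply: ler_sum => c _.
rewrite cmodM mxE.
apply: le_trans (_ : _ <= (\sum_b cmod (A a b * Z b c)) * cmod (S c a)) _.
  by rewrite ler_wpM2r ?cmod_ge0 ?cmod_sum.
rewrite !mulr_suml; apply: ler_sum => b _; rewrite cmodM /k.
by rewrite -mulrA [cmod (Z _ _) * _]mulrC mulrA ler_wpM2l ?mulr_ge0 ?cmod_ge0.
Qed.

Lemma kms_semigroup_first_order (D X Y : 'M[C]_n) : exists K : R,
  forall t, 0 < t <= 1 ->
  cmod (kms D Y (X - Phi t X) - t%:C * kms D Y (L X)) <= K * t ^+ 2.
Proof.
have [K XK] := semigroup_first_order X.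
have [K' K'0 YK] := kms_cmod_bound D Y.
exists (K' * K) => t t01; rewrite -mulrA -kmsZr -kmsBr.
by apply: YK; exact: XK.
Qed.

Lemma kms_semigroup_derivative (D X Y : 'M[C]_n) :
  complex.Re (kms D Y (X - Phi t X)) / t @[t --> 0^'+] --> complex.Re (kms D Y (L X)).
Proof.
have [K XK] := kms_semigroup_first_order D X Y.
have K0 : 0 <= K.
  have := XK 1; rewrite ltr01 lexx expr1n mulr1 => /(_ isT).
  by apply: le_trans; exact: cmod_ge0.
have est t : 0 < t <= 1 ->
    `|complex.Re (kms D Y (L X)) - complex.Re (kms D Y (X - Phi t X)) / t| <= K * t.
  move=> t01; have [t0 _] := andP t01; rewrite -(ler_pM2r t0) -mulrA -expr2.
  apply: le_trans (XK _ t01).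
  have nM (a : R) : `|a| * t = `|a * t| by rewrite normrM (gtr0_norm t0).
  rewrite nM mulrBl divfK ?gt_eqF// distrC.
  apply: le_trans (normr_Re_le _).
  rewrite (raddfB (@complex.Re R : Rcomplex R -> R)) /=.
  have -> : complex.Re (t%:C * kms D Y (L X)) = t * complex.Re (kms D Y (L X)).
    by case: (kms D Y (L X)) => a b /=; rewrite mul0r subr0.
  by rewrite [_ * t]mulrC.
apply/cvgrPdist_le => e e0; near=> t.
have t0 : 0 < t by near: t; exact: nbhs_right_gt.
have t1 : t <= 1 by near: t; exact: nbhs_right_le.
apply: le_trans (est t _) _; first by rewrite t0 t1.
apply: le_trans (_ : _ <= (K + 1) * t) _; first by rewrite ler_wpM2r ?(ltW t0) ?lerDl.
rewrite mulrC -ler_pdivlMr ?ltr_wpDl//; near: t; apply: nbhs_right_le.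
by rewrite divr_gt0 ?ltr_wpDl.
Unshelve. all: by end_near.
Qed.

Lemma generator_kms_symmetric D : psdmx D -> kms_symmetric D Phi ->
  forall X Y, kms D X (L Y) = kms D (L X) Y.
Proof.
move=> D0 Psym X Y; apply/eqP; rewrite -subr_eq0 -cmod_eq0 eq_le cmod_ge0 andbT.
have [K1 XK] := kms_semigroup_first_order D Y X.
have [K2 YK] := kms_semigroup_first_order D X Y.
apply: (@le0_of_linear_bound _ (K1 + K2)) => t t01; have [t0 _] := andP t01.
rewrite -(ler_pM2r t0) -mulrA -expr2 mulrDl.
have hX := XK _ t01; have := YK _ t01; rewrite -cmod_conj.
have -> : (kms D Y (X - Phi t X) - t%:C * kms D Y (L X))^* =
    kms D X (Y - Phi t Y) - t%:C * kms D (L X) Y.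
  rewrite rmorphB rmorphM /= conjC_real (kms_conj _ _ D0) (kms_conj _ _ D0).
  congr (_ - _); rewrite kmsBr (Psym t (ltW t0)) -(kms_conj _ _ D0) kmsBr rmorphB /=.
  by rewrite (kms_conj _ _ D0) (kms_conj _ _ D0).
move: (kms D X (Y - Phi t Y)) (kms D X (L Y)) (kms D (L X) Y) hX => u v w hX hY.
apply: le_trans (lerD hX hY); apply: le_trans (cmodB _ _).
have -> : u - t%:C * v - (u - t%:C * w) = - (t%:C * (v - w)) by ring.
by rewrite cmodN cmodM cmod_real gtr0_norm// mulrC.
Qed.

Lemma generator_trmxC : (forall t, 0 <= t -> forall X, Phi t (X^t*) = (Phi t X)^t*) ->
  forall X, L (X^t*) = (L X)^t*.
Proof.
move=> Ph X; apply/matrixP => i j.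
apply/eqP; rewrite -subr_eq0 -cmod_eq0 eq_le cmod_ge0 andbT.
have [K1 K1P] := semigroup_first_order X.
have [K2 K2P] := semigroup_first_order (X^t*).
apply: (@le0_of_linear_bound _ (K1 + K2)) => t t01; have [t0 _] := andP t01.
rewrite -(ler_pM2r t0) -mulrA -expr2 mulrDl.
have := K1P _ t01 j i; rewrite -cmod_conj; have := K2P _ t01 i j.
rewrite (Ph t (ltW t0)) !mxE !rmorphB rmorphM /= conjC_real.
move: ((X j i)^*) ((Phi t X j i)^*) (L (X^t*) i j) ((L X j i)^*) => x y u v h2 h1.
apply: le_trans (lerD h1 h2); apply: le_trans (cmodB _ _).
have -> : x - y - t%:C * v - (x - y - t%:C * u) = t%:C * (u - v) by ring.
by rewrite cmodM cmod_real gtr0_norm// mulrC.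
Qed.

End Generator.

(** * Spectral decomposition of the generator *)

Section KmsSpectral.
Context {R : realType} {n : nat}.
Local Notation C := R[i].

Lemma mxvec_dot (A B : 'M[C]_n) :
  (mxvec B *m (mxvec A)^t*) 0 0 = \tr (A^t* *m B).
Proof.
rewrite mxE (reindex _ (curry_mxvec_bij n n)) /= sum_pairE exchange_big.
apply: eq_bigr => j _; rewrite mxE; apply: eq_bigr => i _ /=.
by rewrite !mxE !mxvecE mulrC.
Qed.

(** [mxvec] is an isometry onto row vectors, on which [lin_mx F] acts from the right; the
    eigenvectors are therefore the rows of the diagonalizing unitary. *)
Lemma hs_spectral (F : {linear 'M[C]_n -> 'M[C]_n}) :
  (forall X Y, \tr (X^t* *m F Y) = \tr ((F X)^t* *m Y)) ->
  exists (lam : 'I_(n * n) -> R) (E : 'I_(n * n) -> 'M[C]_n),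
    [/\ forall k, F (E k) = (lam k)%:C *: E k,
        forall k l, \tr ((E k)^t* *m E l) = (k == l)%:R &
        forall X, X = \sum_k \tr ((E k)^t* *m X) *: E k].
Proof.
move=> Fsym; pose M : 'M[C]_(n * n) := lin_mx F.
have Mh : M^t* = M.
  have MP (x y : 'rV[C]_(n * n)) : (x *m M *m y^t*) 0 0 = (x *m M^t* *m y^t*) 0 0.
    rewrite -[x]vec_mxK -[y]vec_mxK mul_vec_lin mxvec_dot Fsym -mxvec_dot.
    by rewrite -(mul_vec_lin F) trmxCM mulmxA.
  apply/matrixP => p q; have := MP (delta_mx 0 p) (delta_mx 0 q).
  by rewrite trmxC_delta -!rowE -!colE ![col _ _ _ _]mxE ![row _ _ _ _]mxE.
have [lam _ Msp] := hermitian_spectral Mh.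
have [VV VV'] := (spectralmx_adjK M, spectralmxK M).
move: (spectralmx M) VV VV' Msp => V VV VV' Msp.
exists lam, (fun k => vec_mx (row k V)); split => [k|k l|X].
- apply: (can_inj mxvecK); rewrite -(mul_vec_lin F) linearZ /= !vec_mxK -/M.
  rewrite Msp !mulmxA -row_mul VV -row_mul mul1mx.
  by rewrite row_diag_mx -scalemxAl -rowE mxE.
- rewrite -mxvec_dot !vec_mxK; transitivity ((V *m V^t*) l k).
    by rewrite !mxE; apply: eq_bigr => p _; rewrite !mxE.
  by rewrite VV mxE eq_sym.
- apply: (can_inj mxvecK); rewrite linear_sum /= -{1}[mxvec X]mulmx1 -VV' mulmxA.
  rewrite mulmx_sum_row; apply: eq_bigr => k _; rewrite linearZ /= vec_mxK.
  congr (_ *: _); rewrite -mxvec_dot vec_mxK !mxE; apply: eq_bigr => p _.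
  by rewrite !mxE.
Qed.

(** With W = U D^(1/4), the map X -> W X W^t* carries the KMS product to the Hilbert-Schmidt one,
    because W^t* W = D^(1/2). The entries of [r] are the fourth roots of the eigenvalues of [D]. *)
Lemma kms_spectral (D U : 'M[C]_n) (s : 'I_n -> R) (L : {linear 'M[C]_n -> 'M[C]_n}) :
  kms_frame D U s -> (forall X Y, kms D X (L Y) = kms D (L X) Y) ->
  exists (lam : 'I_(n * n) -> R) (E : 'I_(n * n) -> 'M[C]_n),
    [/\ forall k, L (E k) = (lam k)%:C *: E k,
        forall k l, kms D (E k) (E l) = (k == l)%:R &
        forall X, X = \sum_k kms D (E k) X *: E k].
Proof.
move=> DU Lsym; have [UU UU' s0 SE _] := DU.
pose r i := Num.sqrt (s i).
have r0 i : 0 < r i by rewrite sqrtr_gt0.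
pose W := rdiag r *m U; pose W' := U^t* *m rdiag (fun i => (r i)^-1).
have rr : rdiag r *m rdiag (fun i => (r i)^-1) = 1%:M.
  by rewrite rdiagM -rdiag1; congr rdiag; apply/funext => i; rewrite mulfV ?gt_eqF.
have WW' : W *m W' = 1%:M by rewrite /W /W' mulmxA -(mulmxA _ U) UU mulmx1.
have W'W : W' *m W = 1%:M by exact: mulmx1C.
have WWS : W^t* *m W = mxsqrt D.
  rewrite /W trmxCM trmxC_rdiag mulmxA -(mulmxA _ (rdiag r) (rdiag r)) rdiagM SE.
  have -> : (fun i => r i * r i) = s; last by [].
  by apply/funext => i; rewrite -expr2 sqr_sqrtr// ltW.
clearbody W W'.
pose J (X : 'M[C]_n) := W *m X *m W^t*.
pose J' (X : 'M[C]_n) := W' *m X *m W'^t*.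
have JK X : J' (J X) = X.
  rewrite /J /J' !mulmxA W'W mul1mx -mulmxA -trmxCM W'W.
  by rewrite trmxC1 mulmx1.
have J'K X : J (J' X) = X.
  rewrite /J /J' !mulmxA WW' mul1mx -mulmxA -trmxCM WW'.
  by rewrite trmxC1 mulmx1.
have kmsJ X Y : kms D X Y = \tr ((J X)^t* *m J Y).
  by have := mxtrace_conj W X Y 1%:M; rewrite !mulmx1 WWS.
pose Lh := mulmxr (W^t*) \o (mulmx W \o (L \o (mulmxr (W'^t*) \o mulmx W'))).
pose Lhat : {linear 'M[C]_n -> 'M[C]_n} := Lh.
have LhatE X : Lhat X = J (L (J' X)) by [].
clearbody Lhat.
have Lhsym X Y : \tr (X^t* *m Lhat Y) = \tr ((Lhat X)^t* *m Y).
  by rewrite !LhatE -{1}[X]J'K -[Y in RHS]J'K -!kmsJ Lsym.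
have [lam [E [E1 E2 E3]]] := hs_spectral Lhsym.
exists lam, (fun k => J' (E k)); split => [k|k l|X].
- have := congr1 J' (E1 k); rewrite LhatE JK => ->.
  by rewrite /J' -scalemxAr -scalemxAl.
- by rewrite kmsJ !J'K E2.
- rewrite -{1}[X]JK [J X]E3 /J' mulmx_sumr mulmx_suml; apply: eq_bigr => k _.
  by rewrite kmsJ J'K -scalemxAr -scalemxAl.
Qed.

End KmsSpectral.

Lemma mxtrace_cycle {K : comPzRingType} n (A B U V : 'M[K]_n) :
  \tr (V *m A *m U *m B) = \tr (A *m (U *m B *m V)).
Proof. by rewrite -!mulmxA mxtrace_mulC !mulmxA. Qed.

(** * Comparison of the KMS, GNS and Hilbert-Schmidt norms *)

Section KmsNorms.
Context {R : realType} {n : nat}.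
Local Notation C := R[i].
Implicit Types (X Y : 'M[C]_n).
Variables (D U : 'M[C]_n) (s : 'I_n -> R) (smin smax : R).
Hypotheses (DU : kms_frame D U s) (trD : \tr D = 1) (smin_gt0 : 0 < smin).
Hypothesis s_bounds : forall a, smin <= s a ^+ 2 <= smax.

Definition kms_sq X : R := complex.Re (kms D X X).

Lemma frame_psd : psdmx D.
Proof.
have [_ _ _ _ ->] := DU; apply: psd_conj_rdiag => i.
exact: sqr_ge0.
Qed.

Lemma kms_sqE X : kms_sq X = \sum_a \sum_b s a * s b * nsq (incoord U X a b).
Proof. by rewrite /kms_sq (kms_normE DU). Qed.

Lemma kms_sqC X : kms D X X = (kms_sq X)%:C.
Proof. by rewrite kms_sqE (kms_normE DU). Qed.

Lemma frame_pos a : 0 < s a.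
Proof. by have [_ _ s0 _ _] := DU. Qed.

Lemma kms_sq_ge0 X : 0 <= kms_sq X.
Proof.
rewrite kms_sqE; do 2!apply: sumr_ge0 => ? _.
by rewrite !mulr_ge0 ?nsq_ge0 ?(ltW (frame_pos _)).
Qed.

Lemma smin_le_mul a b : smin <= s a * s b.
Proof.
have [ma _] := andP (s_bounds a); have [mb _] := andP (s_bounds b).
have [sab|/ltW sab] := leP (s a) (s b).
  by apply: le_trans ma _; rewrite expr2 ler_wpM2l// ltW ?frame_pos.
by apply: le_trans mb _; rewrite expr2 ler_wpM2r// ltW ?frame_pos.
Qed.

Lemma smin_hs2_le_kms_sq X : smin * hs2 X <= kms_sq X.
Proof.
rewrite kms_sqE -(hs2_incoord DU) /hs2 mulr_sumr; apply: ler_sum => a _.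
rewrite mulr_sumr; apply: ler_sum => b _.
by rewrite ler_wpM2r ?nsq_ge0 ?smin_le_mul.
Qed.

Lemma kms_sq_gt0 X : X != 0 -> 0 < kms_sq X.
Proof.
move=> X0; apply: lt_le_trans (smin_hs2_le_kms_sq X); rewrite mulr_gt0//.
by rewrite lt_neqAle hs2_ge0 eq_sym hs2_eq0 X0.
Qed.

Definition gns_sq X : R := \sum_a \sum_b s a ^+ 2 * nsq (incoord U X a b).

Lemma gns_sqE X : \tr (D *m (X *m X^t*)) = (gns_sq X)%:C.
Proof.
have [UU UU' _ _ DE] := DU.
have -> : \tr (D *m (X *m X^t*)) =
    \tr (rdiag (fun i => s i ^+ 2) *m (incoord U X *m (incoord U X)^t*)).
  rewrite -incoord_trmxC -(incoordM DU) {1}DE.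
  exact: mxtrace_cycle.
rewrite /gns_sq /mxtrace rmorph_sum; move: (incoord U X) => A.
apply: eq_bigr => a _ /=.
rewrite mul_rdiag_mx mxE mulr_sumr rmorph_sum; apply: eq_bigr => b _ /=.
by rewrite !mxE [A a b * _]mulrC -nsqE -rmorphM.
Qed.

Lemma gns_sq_ge0 X : 0 <= gns_sq X.
Proof.
by do 2!apply: sumr_ge0 => ? _; rewrite mulr_ge0 ?nsq_ge0 ?sqr_ge0.
Qed.

(** Symmetrizing the weights turns the comparison of the two norms into that of the geometric mean s
    a s b with the arithmetic mean of s a ^+ 2 and s b ^+ 2. *)
Lemma gns_sq_sym X : X^t* = X ->
  gns_sq X *+ 2 = \sum_a \sum_b (s a ^+ 2 + s b ^+ 2) * nsq (incoord U X a b).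
Proof.
move=> Xh.
have symm a b : nsq (incoord U X a b) = nsq (incoord U X b a).
  by rewrite -nsq_conj -{2}Xh incoord_trmxC !mxE.
rewrite mulr2n {2}/gns_sq exchange_big -big_split; apply: eq_bigr => a _ /=.
rewrite -big_split; apply: eq_bigr => b _ /=.
by rewrite symm mulrDl.
Qed.

Lemma kms_sq_le_gns X : X^t* = X -> kms_sq X <= gns_sq X.
Proof.
move=> Xh; rewrite -(ler_pMn2r (n := 2))// gns_sq_sym// kms_sqE -sumrMnl.
apply: ler_sum => a _; rewrite -sumrMnl; apply: ler_sum => b _.
rewrite -mulrnAl ler_wpM2r ?nsq_ge0// -subr_ge0.
have -> : s a ^+ 2 + s b ^+ 2 - (s a * s b) *+ 2 = (s a - s b) ^+ 2 by ring.
exact: sqr_ge0.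
Qed.

(** A reversed inequality of means: if x and y lie in [m, M], then (M x - m y) (M y - m x) >= 0,
    which bounds x y / (x^2 + y^2) below by m M / (m^2 + M^2). Here m and M are the roots of [smin]
    and [smax]. *)
Lemma gns_le_kms_sq X : X^t* = X ->
  Num.sqrt (smax * smin) / (smin + smax) * (gns_sq X *+ 2) <= kms_sq X.
Proof.
move=> Xh; rewrite gns_sq_sym// kms_sqE mulr_sumr; apply: ler_sum => a _.
rewrite mulr_sumr; apply: ler_sum => b _; rewrite mulrA ler_wpM2r ?nsq_ge0//.
have [ma Ma] := andP (s_bounds a); have [mb Mb] := andP (s_bounds b).
have smax_gt0 : 0 < smax by apply: lt_le_trans smin_gt0 (le_trans ma Ma).
rewrite mulrAC ler_pdivrMr ?addr_gt0// sqrtrM ?(ltW smax_gt0)//.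
have root_le (x y : R) : 0 <= x -> 0 < y -> x <= y ^+ 2 -> Num.sqrt x <= y.
  move=> x0 y0 xy; rewrite -(ger0_norm (ltW y0)) -sqrtr_sqr.
  exact: ler_wsqrtr.
have le_root (x y : R) : 0 < y -> y ^+ 2 <= x -> y <= Num.sqrt x.
  move=> y0 xy; rewrite -(ger0_norm (ltW y0)) -sqrtr_sqr.
  exact: ler_wsqrtr.
have := root_le _ _ (ltW smin_gt0) (frame_pos a) ma.
have := root_le _ _ (ltW smin_gt0) (frame_pos b) mb.
have := le_root _ _ (frame_pos a) Ma; have := le_root _ _ (frame_pos b) Mb.
have := sqrtr_ge0 smin; have := sqrtr_ge0 smax.
have -> : smin + smax = Num.sqrt smin ^+ 2 + Num.sqrt smax ^+ 2.
  by rewrite !sqr_sqrtr ?ltW.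
move: (Num.sqrt smin) (Num.sqrt smax) (s a) (s b) => m M x y M0 m0 yM xM my mx.
rewrite -subr_ge0.
have -> : x * y * (m ^+ 2 + M ^+ 2) - M * m * (x ^+ 2 + y ^+ 2) =
    (M * x - m * y) * (M * y - m * x) by ring.
have x0 := le_trans m0 mx; have y0 := le_trans m0 my.
by rewrite mulr_ge0// subr_ge0 [M * _]mulrC; apply: ler_pM.
Qed.

Lemma kms_1l X : kms D 1%:M X = state D X.
Proof.
rewrite /kms trmxC1 mul1mx mxtrace_mulC mulmxA mxsqrtK//.
exact: frame_psd.
Qed.

Lemma kms_sq1 : kms_sq 1%:M = 1.
Proof. by rewrite /kms_sq kms_1l /state mulmx1 trD. Qed.

Lemma kms_conjE X Y : (kms D X Y)^* = kms D Y X.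
Proof. exact: kms_conj frame_psd. Qed.

Lemma kmsDl X Y Z : kms D (X + Y) Z = kms D X Z + kms D Y Z.
Proof. by rewrite -kms_conjE kmsDr rmorphD/= !kms_conjE. Qed.

Lemma kmsZl X Y a : kms D (a *: X) Y = a^* * kms D X Y.
Proof. by rewrite -kms_conjE kmsZr rmorphM/= kms_conjE. Qed.

Lemma kms_suml (I : finType) (X : I -> 'M[C]_n) Y :
  kms D (\sum_i X i) Y = \sum_i kms D (X i) Y.
Proof.
rewrite -kms_conjE kms_sumr rmorph_sum; apply: eq_bigr => i _ /=.
exact: kms_conjE.
Qed.

Lemma kms_sq_shift X (c : R) : kms D 1%:M X = 0 ->
  kms_sq (X + (c%:C)%:M) = kms_sq X + c ^+ 2.
Proof.
move=> X0; apply: (@complexI R); rewrite -kms_sqC -scalemx1.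
rewrite kmsDr !kmsDl !kmsZr !kmsZl -[kms D X 1%:M]kms_conjE X0.
rewrite !kms_sqC kms_sq1 conjC_real rmorph0 !mulr0 add0r addr0.
by rewrite mulr1 rmorphD expr2 rmorphM.
Qed.

Definition frame_inv : 'M[C]_n := U^t* *m rdiag (fun i => (s i)^-1) *m U.

Lemma frame_invK : mxsqrt D *m frame_inv = 1%:M.
Proof.
have [UU UU' s0 -> _] := DU; rewrite /frame_inv conj_unitaryM// rdiagM.
have -> : (fun i => s i * (s i)^-1) = fun=> 1.
  by apply/funext => i; rewrite mulfV// gt_eqF.
by rewrite rdiag1 mulmx1.
Qed.

Lemma mxsqrt_trmxC : (mxsqrt D)^t* = mxsqrt D.
Proof. exact/psdmx_hermitian/mxsqrt_psd/frame_psd. Qed.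

Lemma frame_inv_trmxC : frame_inv^t* = frame_inv.
Proof. by rewrite /frame_inv !trmxCM trmxCK trmxC_rdiag mulmxA. Qed.

(** D^(-1/2) X D^(-1/2), the noncommutative density of X relative to D; its squared KMS distance to
    1 is the chi-square distance. *)
Definition relative X : 'M[C]_n := frame_inv *m X *m frame_inv.

Lemma relativeK X : mxsqrt D *m relative X *m mxsqrt D = X.
Proof.
rewrite /relative; move: frame_invK (mulmx1C frame_invK).
move: (mxsqrt D) frame_inv => S T ST TS.
by rewrite !mulmxA ST mul1mx -mulmxA TS mulmx1.
Qed.

Lemma relative_trmxC X : X^t* = X -> (relative X)^t* = relative X.
Proof. move=> Xh; rewrite /relative; move: frame_inv frame_inv_trmxC => T Th.
by rewrite !trmxCM Xh Th mulmxA. Qed.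

Lemma kms_relative X Y : kms D X (relative Y) = \tr (X^t* *m Y).
Proof.
rewrite -{2}[Y]relativeK /kms; move: (mxsqrt D) (relative Y) => S T.
by rewrite !mulmxA.
Qed.

Lemma kms_sq_relative X : kms_sq (relative X) <= smin^-1 * hs2 X.
Proof.
have [UU UU' s0 _ _] := DU.
have E a b : incoord U (relative X) a b = ((s a)^-1 * (s b)^-1)%:C * incoord U X a b.
  have -> : incoord U (relative X) = rdiag (fun i => (s i)^-1) *m incoord U X *m
      rdiag (fun i => (s i)^-1).
    rewrite /relative /frame_inv /incoord !mulmxA UU mul1mx -!mulmxA UU mulmx1.
    by rewrite !mulmxA.
  by rewrite mul_mx_rdiag mul_rdiag_mx rmorphM/=; ring.
rewrite kms_sqE -(hs2_incoord DU) /hs2 mulr_sumr; apply: ler_sum => a _.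
rewrite mulr_sumr; apply: ler_sum => b _; rewrite E nsqM nsq_real mulrA.
rewrite ler_wpM2r ?nsq_ge0//.
have -> : s a * s b * ((s a)^-1 * (s b)^-1) ^+ 2 = (s a * s b)^-1.
  by field; rewrite !gt_eqF.
by rewrite lef_pV2 ?posrE ?mulr_gt0 ?smin_le_mul.
Qed.

Lemma hs2_conj_rdiag (V : 'M[C]_n) (d : 'I_n -> R) : V *m V^t* = 1%:M ->
  hs2 (V^t* *m rdiag d *m V) = \sum_i d i ^+ 2.
Proof.
move=> VV; rewrite hs2_unitaryr// hs2_unitaryl ?trmxCK//.
apply: eq_bigr => i _; rewrite (bigD1 i)//= big1 => [|j ji].
  by rewrite rdiagE eqxx nsq_real addr0.
by rewrite rdiagE eq_sym (negbTE ji) nsq0.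
Qed.

Lemma hs2_density (D' : 'M[C]_n) : density_matrix D' -> hs2 D' <= 1.
Proof.
move=> [D'0 trD']; have [d _ Dsp] := hermitian_spectral (psdmx_hermitian D'0).
have VV := spectralmx_adjK D'.
move: (spectralmx D') VV Dsp => V VV DE.
have d0 i : 0 <= d i.
  have := D'0 (V^t* *m delta_mx i 0).
  rewrite DE trmxCM trmxCK trmxC_delta.
  rewrite !mulmxA -(mulmxA _ V) VV mulmx1 -(mulmxA _ V) VV mulmx1.
  by rewrite -rowE -colE !mxE eqxx mulr1n lecR.
have d1 : \sum_i d i = 1.
  apply: (@complexI R); rewrite rmorph1 -trD' DE -mulmxA mxtrace_mulC -mulmxA VV mulmx1.
  by rewrite rmorph_sum; apply: eq_bigr => i _; rewrite rdiagE eqxx.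
rewrite DE hs2_conj_rdiag// -d1; apply: ler_sum => i _.
rewrite expr2 ler_piMl// -d1 (bigD1 i)//= lerDl.
by apply: sumr_ge0.
Qed.

End KmsNorms.

(** * Conductance, spectral gap and mixing *)

Lemma idempotent_shift_sq {K : comPzRingType} n (P : 'M[K]_n) (z : K) : P *m P = P ->
  (P - z%:M) *m (P - z%:M) = P - z *: P - (z *: P - (z * z) *: 1%:M).
Proof.
move=> PP; rewrite mulmxBl !mulmxBr PP mul_mx_scalar !mul_scalar_mx.
by rewrite !scale_scalar_mx mulr1.
Qed.

Lemma cvg_sum_seq {R : realType} (I : Type) (r : seq I) (f : I -> R -> R) (l : I -> R)
    (F : set_system R) :
  Filter F -> (forall i, f i t @[t --> F] --> l i) ->
  \sum_(i <- r) f i t @[t --> F] --> \sum_(i <- r) l i.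
Proof.
move=> FF fl; elim: r => [|i r IH].
  by rewrite big_nil; under eq_fun do rewrite big_nil; exact: cvg_cst.
rewrite big_cons; under eq_fun do rewrite big_cons.
by apply: cvgD.
Qed.

Section EigenExpansion.
Context {R : realType} {n N : nat}.
Local Notation C := R[i].
Implicit Types (X Y : 'M[C]_n).
Variables (D U : 'M[C]_n) (s : 'I_n -> R) (smin smax : R).
Hypotheses (DU : kms_frame D U s) (trD : \tr D = 1) (smin_gt0 : 0 < smin).
Hypothesis s_bounds : forall a, smin <= s a ^+ 2 <= smax.
Variables (Phi : R -> {linear 'M[C]_n -> 'M[C]_n}) (L : {linear 'M[C]_n -> 'M[C]_n}).
Hypotheses (Phi_qms : quantum_markov_semigroup Phi) (Phi_L : is_generator Phi L).
Hypothesis Phi_sym : kms_symmetric D Phi.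
Hypothesis kerL : forall X, L X = 0 <-> exists c : C, X = c%:M.
Variables (lam : 'I_N -> R) (E : 'I_N -> 'M[C]_n).
Hypothesis LE : forall k, L (E k) = (lam k)%:C *: E k.
Hypothesis Eorth : forall k l, kms D (E k) (E l) = (k == l)%:R.
Hypothesis Ecomplete : forall X, X = \sum_k kms D (E k) X *: E k.

Let D0 : psdmx D := frame_psd DU.

Lemma kms_parseval X Y :
  kms D X Y = \sum_k (kms D (E k) X)^* * kms D (E k) Y.
Proof.
rewrite {1}[X]Ecomplete (kms_suml DU); apply: eq_bigr => k _.
by rewrite (kmsZl DU).
Qed.

Lemma kms_sq_parseval X : kms_sq D X = \sum_k nsq (kms D (E k) X).
Proof.
apply: (@complexI R); rewrite -(kms_sqC DU) kms_parseval rmorph_sum.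
by apply: eq_bigr => k _ /=; rewrite -nsqE.
Qed.

Lemma gen_kms_sym X Y : kms D X (L Y) = kms D (L X) Y.
Proof. exact: (generator_kms_symmetric Phi_L D0 Phi_sym). Qed.

Lemma semigroup_trmxC t X : 0 <= t -> Phi t (X^t*) = (Phi t X)^t*.
Proof. by move=> t0; apply: cp_trmxC; exact: qms_cp Phi_qms t t0. Qed.

Lemma gen_trmxC X : L (X^t*) = (L X)^t*.
Proof. by apply: (generator_trmxC Phi_L) => t t0 Y; exact: semigroup_trmxC. Qed.

Lemma gen1 : L 1%:M = 0.
Proof. by apply/kerL; exists 1. Qed.

Lemma kms_1_gen X : kms D 1%:M (L X) = 0.
Proof. by rewrite gen_kms_sym gen1 -(kms_conjE DU) /kms mulmx0 mul0mx raddf0 rmorph0. Qed.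

Lemma coef_gen k X : kms D (E k) (L X) = (lam k)%:C * kms D (E k) X.
Proof. by rewrite gen_kms_sym LE (kmsZl DU) conjC_real. Qed.

Lemma coef_semigroup k t X : 0 <= t ->
  kms D (E k) (Phi t X) = (expR (- (t * lam k)))%:C * kms D (E k) X.
Proof.
move=> t0; rewrite Phi_sym// (semigroup_eigen Phi_L t0 (LE k)).
by rewrite (kmsZl DU) conjC_real.
Qed.

Lemma dirichlet_parseval X :
  complex.Re (kms D X (L X)) = \sum_k lam k * nsq (kms D (E k) X).
Proof.
have -> : kms D X (L X) = (\sum_k lam k * nsq (kms D (E k) X))%:C; last by [].
rewrite kms_parseval rmorph_sum; apply: eq_bigr => k _ /=.
by rewrite coef_gen mulrCA -nsqE -rmorphM.
Qed.

(** Eigenvectors for 0 are scalar matrices, so a matrix of mean zero sees only the nonzero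
    eigenvalues. *)
Lemma coef_mean_zero k X : kms D 1%:M X = 0 -> lam k = 0 -> kms D (E k) X = 0.
Proof.
move=> X0 lk; have /kerL[c ->] : L (E k) = 0 by rewrite LE lk scale0r.
by rewrite -scalemx1 (kmsZl DU) X0 mulr0.
Qed.

Lemma kms_sq_decay t a X : 0 <= t -> (forall k, lam k != 0 -> a <= t * lam k) ->
  kms D 1%:M X = 0 -> kms_sq D (Phi t X) <= expR (- a) ^+ 2 * kms_sq D X.
Proof.
move=> t0 lama X0; rewrite !kms_sq_parseval mulr_sumr; apply: ler_sum => k _.
rewrite coef_semigroup// nsqM nsq_real; have [lk|lk] := eqVneq (lam k) 0.
  by rewrite (coef_mean_zero X0 lk) nsq0 !mulr0.
rewrite ler_wpM2r ?nsq_ge0// lerXn2r ?nnegrE ?expR_ge0//.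
by rewrite ler_expR lerN2 lama.
Qed.

Lemma poincare g X : (forall k, lam k != 0 -> g <= lam k) ->
  kms D 1%:M X = 0 -> g * kms_sq D X <= complex.Re (kms D X (L X)).
Proof.
move=> lamg X0; rewrite dirichlet_parseval kms_sq_parseval mulr_sumr.
apply: ler_sum => k _; have [lk|lk] := eqVneq (lam k) 0.
  by rewrite (coef_mean_zero X0 lk) nsq0 !mulr0.
by rewrite ler_wpM2r ?nsq_ge0 ?lamg.
Qed.

Lemma eigenbasis_neq0 k : E k != 0.
Proof.
apply/eqP => E0; have := Eorth k k; rewrite E0 eqxx /kms mulmx0 mul0mx raddf0.
by move=> /esym/eqP; rewrite oner_eq0.
Qed.

(** [L] commutes with adjoints and its eigenvalues are real: the Hermitian part of [E k] serves, or
    the skew part times i when the former vanishes. *)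
Lemma hermitian_eigenvector k : exists X,
  [/\ X != 0, X^t* = X & L X = (lam k)%:C *: X].
Proof.
pose A := E k + (E k)^t*; pose B := 'i *: (E k - (E k)^t*).
have LEt : L ((E k)^t*) = (lam k)%:C *: (E k)^t*.
  by rewrite gen_trmxC LE trmxCZ conjC_real.
have [A0|A0] := eqVneq A 0; last first.
  exists A; split => //; first by rewrite /A trmxCD trmxCK addrC.
  by rewrite /A raddfD /= LE LEt scalerDr.
exists B; split.
- apply/eqP => B0; have := eigenbasis_neq0 k; case/negP.
  have : 'i *: B = 0 by rewrite B0 scaler0.
  rewrite /B scalerA -expr2 sqrCi scaleN1r opprB => /eqP.
  rewrite subr_eq0 => /eqP Eh; move: A0; rewrite /A Eh -mulr2n => /eqP.
  by rewrite -scaler_nat scaler_eq0 pnatr_eq0.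
- by rewrite /B trmxCZ trmxCB trmxCK conjCi scaleNr -scalerN opprB.
- by rewrite /B linearZ /= raddfB /= LE LEt -scalerBr !scalerA mulrC.
Qed.

(** For a Hermitian eigenvector X, the commutator formula at time 1 writes (1 - e^(- lam k)) <X, X>
    as a sum of squares. *)
Lemma eigenvalue_ge0 k : 0 <= lam k.
Proof.
have [X [X0 Xh LX]] := hermitian_eigenvector k.
have Pcp := qms_cp Phi_qms ler01; have P1 := qms_unital Phi_qms ler01.
have [M [V VE]] := commutator_form DU Pcp P1 (Phi_sym ler01).
have PX := semigroup_eigen Phi_L ler01 LX; rewrite mul1r in PX.
have := VE X Xh; rewrite PX kmsZr (kms_sqC DU) => VX.
have : 0 <= ((1 - expR (- lam k)) * kms_sq D X)%:C.
  rewrite mulrBl mul1r rmorphB rmorphM VX; apply: sumr_ge0 => j _.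
  by rewrite (kms_sqC DU) ler0c (kms_sq_ge0 DU).
rewrite ler0c pmulr_lge0 ?(kms_sq_gt0 DU smin_gt0 s_bounds)// subr_ge0.
by rewrite -[leRHS]expR0 ler_expR oppr_le0.
Qed.

Lemma eigenvalue_le_norm k : lam k <= map_norm (kms_norm D) L.
Proof.
have kn X : kms_norm D X = Num.sqrt (kms_sq D X) by [].
have nE : kms_norm D (E k) = 1 by rewrite kn /kms_sq Eorth eqxx sqrtr1.
have -> : lam k = kms_norm D (L (E k)) / kms_norm D (E k).
  rewrite nE divr1 LE kn /kms_sq kmsZr (kmsZl DU) Eorth eqxx mulr1 conjC_real.
  by rewrite -rmorphM /= -expr2 sqrtr_sqr ger0_norm ?eigenvalue_ge0.
apply: ub_le_sup; last by exists (E k) => //; exact: eigenbasis_neq0.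
(* Any upper bound of the ratios makes the supremum meaningful; the sum of the nonnegative
   eigenvalues is one. *)
pose B := \sum_j lam j.
have B0 : 0 <= B by apply: sumr_ge0 => j _; exact: eigenvalue_ge0.
exists B => _ [X X0 <-]; have X1 := kms_sq_gt0 DU smin_gt0 s_bounds X0.
rewrite ler_pdivrMr ?kn ?sqrtr_gt0// -[B]ger0_norm// -sqrtr_sqr -sqrtrM ?sqr_ge0//.
rewrite ler_wsqrtr// !kms_sq_parseval mulr_sumr; apply: ler_sum => j _.
rewrite coef_gen nsqM nsq_real ler_wpM2r ?nsq_ge0//.
rewrite lerXn2r ?nnegrE ?eigenvalue_ge0//.
by rewrite /B (bigD1 j)//= lerDl; apply: sumr_ge0 => l _; exact: eigenvalue_ge0.
Qed.

Lemma dirichlet_le_norm X :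
  complex.Re (kms D X (L X)) <= map_norm (kms_norm D) L * kms_sq D X.
Proof.
rewrite dirichlet_parseval kms_sq_parseval mulr_sumr; apply: ler_sum => k _.
by rewrite ler_wpM2r ?nsq_ge0 ?eigenvalue_le_norm.
Qed.

Lemma kms_CauchySchwarz X Y : complex.Re (kms D X Y) <=
  Num.sqrt (kms_sq D X) * Num.sqrt (kms_sq D Y).
Proof.
apply: le_trans (ler_norm _) _; apply: le_trans (normr_Re_le _) _.
rewrite kms_parseval; apply: le_trans (cmod_sum _ _) _.
pose a k := cmod (kms D (E k) X); pose b k := cmod (kms D (E k) Y).
have SX : \sum_k 1 * a k ^+ 2 = kms_sq D X.
  by rewrite kms_sq_parseval; apply: eq_bigr => k _; rewrite mul1r sqr_cmod.
have SY : \sum_k 1 * b k ^+ 2 = kms_sq D Y.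
  by rewrite kms_sq_parseval; apply: eq_bigr => k _; rewrite mul1r sqr_cmod.
have -> : \sum_k cmod ((kms D (E k) X)^* * kms D (E k) Y) = \sum_k 1 * (a k * b k).
  by apply: eq_bigr => k _; rewrite mul1r cmodM cmod_conj.
clearbody a b; have h : (\sum_k 1 * (a k * b k)) ^+ 2 <=
    (\sum_k 1 * a k ^+ 2) * (\sum_k 1 * b k ^+ 2).
  exact: weighted_CauchySchwarz.
rewrite SX SY in h; move: (\sum_k _) h => S h.
rewrite -sqrtrM ?(kms_sq_ge0 DU)//; apply: le_trans (ler_norm _) _.
by rewrite -sqrtr_sqr ler_wsqrtr.
Qed.

(** * Conductance against the spectral gap *)

Implicit Types (P Q : 'M[C]_n).
Local Notation h := (conductance D L).
Local Notation opL := (map_norm (kms_norm D) L).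

Hypothesis n_ge2 : (2 <= n)%N.

Lemma smax_gt0 : 0 < smax.
Proof.
have i0 : 'I_n by exists 0%N; exact: ltnW.
by have [a b] := andP (s_bounds i0); exact: lt_le_trans smin_gt0 (le_trans a b).
Qed.

Lemma projection_state P : orthogonal_projection P ->
  state D P = (gns_sq U s P)%:C.
Proof. by move=> [Ph PP]; rewrite -(gns_sqE DU) Ph PP. Qed.

Lemma gns_sq_gt0 X : X^t* = X -> X != 0 -> 0 < gns_sq U s X.
Proof.
move=> Xh X0; apply: lt_le_trans (kms_sq_le_gns DU Xh).
exact: (kms_sq_gt0 DU smin_gt0 s_bounds).
Qed.

Lemma orthogonal_projectionC P : orthogonal_projection P ->
  orthogonal_projection (1%:M - P).
Proof.
move=> [Ph PP]; split; first by rewrite trmxCB trmxC1 Ph.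
by rewrite mulmxBl mulmxBr !mul1mx mulmxBr mulmx1 PP subrr subr0.
Qed.

Lemma projection_prob P : orthogonal_projection P -> P != 0 -> P != 1%:M ->
  0 < gns_sq U s P < 1.
Proof.
move=> Pp P0 P1; rewrite gns_sq_gt0//=; last by case: Pp.
have Qp := orthogonal_projectionC Pp.
have : 0 < gns_sq U s (1%:M - P).
  by apply: gns_sq_gt0; [case: Qp | rewrite subr_eq0 eq_sym].
suff -> : gns_sq U s (1%:M - P) = 1 - gns_sq U s P by rewrite subr_gt0.
apply: (@complexI R); rewrite -projection_state// /state mulmxBr raddfB /=.
by rewrite mulmx1 trD rmorphB /= -projection_state.
Qed.

Lemma gen_scalar (c : C) : L c%:M = 0.
Proof. by apply/kerL; exists c. Qed.

Lemma gen_shift X (c : C) : L (X - c%:M) = L X.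
Proof. by rewrite raddfB /= gen_scalar subr0. Qed.

Lemma dirichlet_shift X (c : C) :
  kms D (X - c%:M) (L (X - c%:M)) = kms D X (L X).
Proof.
rewrite gen_shift -(kms_conjE DU) kmsBr -scalemx1 kmsZr rmorphB rmorphM /=.
by rewrite !(kms_conjE DU) kms_1_gen mulr0 subr0.
Qed.

Lemma gns_sq_projection_shift P : orthogonal_projection P ->
  let p := gns_sq U s P in gns_sq U s (P - (p%:C)%:M) = p * (1 - p).
Proof.
move=> Pp p; have := projection_state Pp; rewrite -/p; case: Pp => Ph PP sp.
apply: (@complexI R); rewrite -(gns_sqE DU).
have -> : (P - (p%:C)%:M)^t* = P - (p%:C)%:M.
  by rewrite trmxCB Ph trmxC_scalar conjC_real.
have -> : (P - (p%:C)%:M) *m (P - (p%:C)%:M) =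
    P - p%:C *: P - (p%:C *: P - (p%:C * p%:C) *: 1%:M).
  exact: idempotent_shift_sq.
have trDB (A B : 'M[C]_n) : \tr (D *m (A - B)) = \tr (D *m A) - \tr (D *m B).
  by rewrite mulmxBr raddfB.
have trDZ (a : C) (A : 'M[C]_n) : \tr (D *m (a *: A)) = a * \tr (D *m A).
  by rewrite -scalemxAr mxtraceZ.
rewrite !trDB !trDZ mulmx1 trD -/(state D P) sp rmorphM rmorphB /=.
by move: (p%:C) => z; ring.
Qed.

(** The Dirichlet form ignores scalars, so [P] may be centred at its mean p and the Poincare
    inequality applies; p (1 - p) is the GNS variance. *)
Lemma dirichlet_projection_ge g P : 0 <= g ->
  (forall k, lam k != 0 -> g <= lam k) -> orthogonal_projection P ->
  g * (Num.sqrt (smax * smin) / (smin + smax)) *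
    (gns_sq U s P * (1 - gns_sq U s P) *+ 2) <= complex.Re (kms D P (L P)).
Proof.
move=> g0 lamg Pp; set p := gns_sq U s P; rewrite -(dirichlet_shift P (p%:C)).
have Yh : (P - (p%:C)%:M)^t* = P - (p%:C)%:M.
  by case: Pp => Ph _; rewrite trmxCB Ph trmxC_scalar conjC_real.
apply: le_trans (poincare lamg _); last first.
  rewrite (kms_1l DU) /state mulmxBr raddfB /= -/(state D P) projection_state//.
  by rewrite mul_mx_scalar mxtraceZ trD mulr1 subrr.
rewrite -mulrA ler_wpM2l//.
rewrite -gns_sq_projection_shift//.
exact: (gns_le_kms_sq DU smin_gt0 s_bounds Yh).
Qed.

Lemma dirichlet_ge0 X : 0 <= complex.Re (kms D X (L X)).
Proof.
rewrite dirichlet_parseval; apply: sumr_ge0 => k _.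
by rewrite mulr_ge0 ?nsq_ge0 ?eigenvalue_ge0.
Qed.

Lemma conductance_ge g : 0 <= g -> (forall k, lam k != 0 -> g <= lam k) ->
  g * (Num.sqrt (smax * smin) / (smin + smax)) <= h.
Proof.
move=> g0 lamg; apply: lb_le_inf.
  (* The infimum must be over a nonempty set: as n >= 2, the rank-one [delta_mx i0 i0] is neither 0
     nor 1. *)
  pose i0 : 'I_n := Ordinal (ltnW n_ge2); pose i1 : 'I_n := Ordinal n_ge2.
  exists (complex.Re (kms D (delta_mx i0 i0) (L (delta_mx i0 i0))) /
    Num.min (complex.Re (state D (delta_mx i0 i0)))
            (1 - complex.Re (state D (delta_mx i0 i0)))).
  exists (delta_mx i0 i0) => //; split.
  - by split; [exact: trmxC_delta | exact: mul_delta_mx].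
  - by apply/eqP => /matrixP/(_ i0 i0)/eqP; rewrite !mxE !eqxx oner_eq0.
  - by apply/eqP => /matrixP/(_ i1 i1)/eqP; rewrite !mxE !eqxx eq_sym oner_eq0.
move=> _ [P [Pp P0 P1] <-].
have [p0 p1] := andP (projection_prob Pp P0 P1).
have := dirichlet_projection_ge g0 lamg Pp.
rewrite projection_state//=; move: (gns_sq U s P) p0 p1 => p p0 p1 Ege.
have q0 : 0 < Num.min p (1 - p) by rewrite lt_min p0 subr_gt0.
rewrite ler_pdivlMr//; apply: le_trans Ege; rewrite ler_wpM2l//.
  by rewrite mulr_ge0// divr_ge0 ?sqrtr_ge0// addr_ge0 ?ltW ?smax_gt0.
(* This is min(p, 1 - p) <= 2 p (1 - p), the larger of p and 1 - p being at least 1/2. *)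
rewrite /Num.min; case: ifP => [|/negbT]; rewrite -?leNgt; nra.
Qed.

Lemma conductance_le P : orthogonal_projection P -> P != 0 -> P != 1%:M ->
  h * Num.min (gns_sq U s P) (1 - gns_sq U s P) <= complex.Re (kms D P (L P)).
Proof.
move=> Pp P0 P1; set p := gns_sq U s P; have [p0 p1] := andP (projection_prob Pp P0 P1).
have q0 : 0 < Num.min p (1 - p) by rewrite lt_min p0 subr_gt0.
rewrite -ler_pdivlMr//; apply: ge_inf; last first.
  by exists P => //; rewrite projection_state.
exists 0 => _ [Q [Qp Q0 Q1] <-]; rewrite divr_ge0 ?dirichlet_ge0//.
have [r0 r1] := andP (projection_prob Qp Q0 Q1).
by rewrite (projection_state Qp) /= le_min subr_ge0 !ltW.
Qed.

(** Were all eigenvalues 0, [L] would vanish and a diagonal matrix unit would be scalar, which n >=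
    2 excludes. *)
Lemma spectral_gap : exists2 k, 0 < lam k & forall j, lam j != 0 -> lam k <= lam j.
Proof.
case: (pickP [pred k | lam k != 0]) => [k0 k0P|none].
  case: (arg_minP lam k0P) => k kP kmin; exists k => //.
  by rewrite lt_neqAle eigenvalue_ge0 eq_sym andbT.
pose i0 : 'I_n := Ordinal (ltnW n_ge2); pose i1 : 'I_n := Ordinal n_ge2.
have : L (delta_mx i0 i0) = 0.
  rewrite [delta_mx i0 i0]Ecomplete raddf_sum /= big1// => k _.
  have /negbFE/eqP lk := none k.
  by rewrite linearZ /= LE lk scale0r scaler0.
move=> /kerL[c] /matrixP ce; have := ce i1 i1; have := ce i0 i0.
by rewrite !mxE !eqxx /= => <- /eqP; rewrite eq_sym oner_eq0.
Qed.

Lemma conductance_gt0 : 0 < h.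
Proof.
have [k k0 kmin] := spectral_gap.
apply: lt_le_trans (conductance_ge (ltW k0) kmin).
by rewrite mulr_gt0// divr_gt0 ?sqrtr_gt0 ?mulr_gt0 ?addr_gt0 ?smax_gt0.
Qed.

(* For each t > 0 the form <Z, (1 - Phi_t) Z> / t is comparable, within the
   factors smin and smax, to the energy of a nonnegative weighted graph, to which
   [cheeger_levels] applies; the inequality survives the limit t -> 0. *)
Lemma dirichlet_levels (G : 'M[C]_n) (y : 'I_n -> R) (lv : seq (R * {set 'I_n}))
    (e := fun z => complex.Re (kms D (udiag G z) (L (udiag G z)))) :
  G *m G^t* = 1%:M -> (forall p, p \in lv -> 0 <= p.1) ->
  (forall w, (forall i k, 0 <= w i k) ->
    (\sum_(p <- lv) p.1 * edge_energy w (indicator p.2)) ^+ 2 <=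
    edge_energy w y *
      (2 * \sum_j y j ^+ 2 * edge_energy w (indicator [set j]%SET))) ->
  (smin * \sum_(p <- lv) p.1 * e (indicator p.2)) ^+ 2 <=
  smax ^+ 2 * (e y * (2 * \sum_j y j ^+ 2 * e (indicator [set j]%SET))).
Proof.
move=> GG lv0 lvw; have M0 := smax_gt0.
pose f z t := complex.Re (kms D (udiag G z) (udiag G z - Phi t (udiag G z))).
have fe z : f z t / t @[t --> 0^'+] --> e z by exact: kms_semigroup_derivative.
pose lhs t := (smin * \sum_(p <- lv) p.1 * (f (indicator p.2) t / t)) ^+ 2.
pose rhs t := smax ^+ 2 * (f y t / t *
  (2 * \sum_j y j ^+ 2 * (f (indicator [set j]%SET) t / t))).
have lhsP : lhs t @[t --> 0^'+] --> (smin * \sum_(p <- lv) p.1 * e (indicator p.2)) ^+ 2.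
  rewrite expr2 /lhs; under eq_fun do rewrite expr2.
  have S : smin * (\sum_(p <- lv) p.1 * (f (indicator p.2) t / t)) @[t --> 0^'+] -->
      smin * (\sum_(p <- lv) p.1 * e (indicator p.2)).
    apply: cvgM; first exact: cvg_cst.
    by apply: cvg_sum_seq => p; apply: cvgM; [exact: cvg_cst | exact: fe].
  exact: cvgM.
have rhsP : rhs t @[t --> 0^'+] -->
    smax ^+ 2 * (e y * (2 * \sum_j y j ^+ 2 * e (indicator [set j]%SET))).
  apply: cvgM; first exact: cvg_cst.
  apply: cvgM; first exact: fe.
  apply: cvgM; first exact: cvg_cst.
  by apply: cvg_sum_seq => j; apply: cvgM; [exact: cvg_cst | exact: fe].
apply: ler_cvg_to lhsP rhsP _; near=> t.
have t0 : 0 < t by near: t; exact: nbhs_right_gt.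
have [w w0 wP] := dirichlet_weights DU (qms_cp Phi_qms (ltW t0))
  (qms_unital Phi_qms (ltW t0)) (Phi_sym (ltW t0)) GG (ltW smin_gt0) s_bounds.
have qf z : smin * edge_energy w z <= f z t /\ f z t <= smax * edge_energy w z.
  by apply/andP; rewrite /f kmsBr; exact: (wP z _ _ (erefl _) (erefl _)).
rewrite /lhs /rhs.
have -> : \sum_(p <- lv) p.1 * (f (indicator p.2) t / t) =
    (\sum_(p <- lv) p.1 * f (indicator p.2) t) / t.
  by rewrite mulr_suml; apply: eq_bigr => p _; rewrite mulrA.
have -> : \sum_j y j ^+ 2 * (f (indicator [set j]%SET) t / t) =
    (\sum_j y j ^+ 2 * f (indicator [set j]%SET) t) / t.
  by rewrite mulr_suml; apply: eq_bigr => j _; rewrite mulrA.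
set A := \sum_(p <- lv) _; set B := \sum_j _.
suff AB : (smin * A) ^+ 2 <= smax ^+ 2 * (f y t * (2 * B)).
  have -> : (smin * (A / t)) ^+ 2 = (smin * A) ^+ 2 * t^-1 ^+ 2 by ring.
  have -> : smax ^+ 2 * (f y t / t * (2 * (B / t))) =
    smax ^+ 2 * (f y t * (2 * B)) * t^-1 ^+ 2 by ring.
  by rewrite ler_wpM2r ?sqr_ge0.
pose q := edge_energy w.
have q0 z : 0 <= q z by exact: edge_energy_ge0.
pose Q := \sum_(p <- lv) p.1 * q (indicator p.2).
pose S := \sum_j y j ^+ 2 * q (indicator [set j]%SET).
have f0 z : 0 <= f z t.
  by have [a _] := qf z; apply: le_trans a; rewrite mulr_ge0 ?(ltW smin_gt0) ?q0.
have Q0 : 0 <= Q by rewrite /Q big_seq; apply: sumr_ge0 => p /lv0 p0; rewrite mulr_ge0.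
have A0 : 0 <= A by rewrite /A big_seq; apply: sumr_ge0 => p /lv0 p0; rewrite mulr_ge0.
have AQ : A <= smax * Q.
  rewrite /A /Q mulr_sumr !big_seq; apply: ler_sum => p /lv0 p0.
  by rewrite mulrCA ler_wpM2l//; have [_ ?] := qf (indicator p.2).
have SB : smin * S <= B.
  rewrite /B /S mulr_sumr; apply: ler_sum => j _.
  by rewrite mulrCA ler_wpM2l ?sqr_ge0//; have [? _] := qf (indicator [set j]%SET).
have S0 : 0 <= S by apply: sumr_ge0 => j _; rewrite mulr_ge0 ?sqr_ge0.
have [qy _] := qf y; have QS : Q ^+ 2 <= q y * (2 * S) by exact: lvw.
(* [AQ] costs smax^2, while [qy] and [SB] each absorb one factor smin. *)
rewrite exprMn; apply: le_trans (_ : _ <= smin ^+ 2 * (smax * Q) ^+ 2) _.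
  by rewrite ler_wpM2l ?sqr_ge0// lerXn2r ?nnegrE// mulr_ge0// ltW.
have -> : smin ^+ 2 * (smax * Q) ^+ 2 = smax ^+ 2 * (smin ^+ 2 * Q ^+ 2) by ring.
rewrite ler_wpM2l ?sqr_ge0//.
apply: le_trans (_ : _ <= smin ^+ 2 * (q y * (2 * S))) _.
  by rewrite ler_wpM2l ?sqr_ge0.
have -> : smin ^+ 2 * (q y * (2 * S)) = (smin * q y) * (2 * (smin * S)) by ring.
have m0 := ltW smin_gt0.
by apply: ler_pM; rewrite ?mulr_ge0 ?q0// ler_wpM2l.
Unshelve. all: by end_near.
Qed.

Lemma gns_sq_udiag (G : 'M[C]_n) (z : 'I_n -> R) : G *m G^t* = 1%:M ->
  gns_sq U s (udiag G z) = \sum_i complex.Re ((G *m D *m G^t*) i i) * z i ^+ 2.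
Proof.
move=> GG; have := gns_sqE DU (udiag G z); rewrite udiag_trmxC (udiagM _ _ GG) => Ez.
have -> : gns_sq U s (udiag G z) = complex.Re (\tr (D *m udiag G (fun i => z i * z i))).
  by rewrite Ez.
by rewrite Re_mxtrace_mul_udiag; apply: eq_bigr => i _; rewrite expr2.
Qed.

Lemma cheeger_bound k : lam k != 0 ->
  smin ^+ 2 * h ^+ 2 <= 2 * smax ^+ 2 * opL * lam k.
Proof.
move=> lk; have lk0 : 0 < lam k by rewrite lt_neqAle eigenvalue_ge0 eq_sym lk.
have [X [X0 Xh LX]] := hermitian_eigenvector k.
have X1 : kms D 1%:M X = 0.
  have := kms_1_gen X; rewrite LX kmsZr => /eqP; rewrite mulf_eq0 => /orP[|/eqP//].
  by rewrite -(rmorph0 (real_complex R)) (inj_eq (@complexI _)) (negbTE lk).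
have [x _ Xsp] := hermitian_spectral Xh.
have GG := spectralmx_adjK X; have GG' := spectralmxK X.
move: (spectralmx X) GG GG' Xsp => G GG GG' Xsp.
pose pi i := complex.Re ((G *m D *m G^t*) i i).
have gnsE z : gns_sq U s (udiag G z) = \sum_i pi i * z i ^+ 2 by exact: gns_sq_udiag.
have piE i : pi i = gns_sq U s (udiag G (indicator [set i]%SET)).
  rewrite gnsE (bigD1 i)//= big1 => [|j ji].
    by rewrite /indicator finset.in_set1 eqxx expr1n mulr1 addr0.
  by rewrite /indicator finset.in_set1 (negbTE ji) expr0n mulr0.
have pi0 i : 0 <= pi i by rewrite piE gns_sq_ge0.
have pi1 : \sum_i pi i = 1.
  have := gnsE (fun=> 1); rewrite (udiag1 GG') => gE.
  transitivity (gns_sq U s 1%:M).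
    by rewrite gE; apply: eq_bigr => i _; rewrite expr1n mulr1.
  by apply: (@complexI R); rewrite -(gns_sqE DU) mul1mx trmxC1 mulmx1 trD.
(* Each level set lies in {y > 0} or in {y < 0}, hence has mass at most 1/2 and attains the minimum
   in the definition of the conductance by its own mass. *)
have [m [mp mn]] := median_exists x pi0 pi1.
pose y i := x i - m.
have yE : udiag G y = X - (m%:C)%:M.
  rewrite -scalemx1 -(udiag1 GG') Xsp /udiag scalemxAl scalemxAr -mulmxBl -mulmxBr.
  congr (_ *m _ *m _); apply/matrixP => i j; rewrite !mxE /y.
  by case: (i == j); rewrite ?mulr1n ?mulr0n ?mulr1 ?mulr0 ?subr0// rmorphB.
have [lv [lv1 lv2 lv3]] := cheeger_levels y.
have lv0 p : p \in lv -> 0 <= p.1 by move=> /lv1[].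
pose e z := complex.Re (kms D (udiag G z) (L (udiag G z))).
have main : (smin * \sum_(p <- lv) p.1 * e (indicator p.2)) ^+ 2 <=
    smax ^+ 2 * (e y * (2 * \sum_j y j ^+ 2 * e (indicator [set j]%SET))).
  exact: dirichlet_levels GG lv0 lv3.
pose V := \sum_i pi i * y i ^+ 2.
have indV p : p \in lv -> h * (\sum_i pi i * indicator p.2 i) <= e (indicator p.2).
  move=> /lv1[_ A0 Ay]; have GP : gns_sq U s (udiag G (indicator p.2)) =
      \sum_i pi i * indicator p.2 i.
    rewrite gnsE; apply: eq_bigr => i _; rewrite /indicator.
    by case: (i \in p.2); rewrite ?expr1n ?expr0n.
  have half : \sum_i pi i * indicator p.2 i <= 2^-1.
    have subsum (a : pred 'I_n) : {subset p.2 <= a} ->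
        \sum_i pi i * indicator p.2 i <= \sum_(i | a i) pi i.
      move=> sub; rewrite [leRHS]big_mkcond; apply: ler_sum => i _; rewrite /indicator.
      case: (boolP (i \in p.2)) => [/sub|_].
        by rewrite unfold_in => ->; rewrite mulr1.
      by rewrite mulr0; case: ifP.
    case: Ay => sub.
      apply: le_trans mp; apply: subsum => i /sub.
      by rewrite !unfold_in /= /y subr_gt0.
    apply: le_trans mn; apply: subsum => i /sub.
    by rewrite !unfold_in /= /y subr_lt0.
  have Pp : orthogonal_projection (udiag G (indicator p.2)).
    split; first exact: udiag_trmxC.
    rewrite (udiagM _ _ GG); congr (udiag G _); apply/funext => i.
    by rewrite /indicator; case: (i \in p.2); rewrite ?mulr1 ?mulr0.
  have P0 : udiag G (indicator p.2) != 0.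
    have [i iA] := set0Pn _ A0; apply/eqP => PE.
    have P0E : udiag G (indicator p.2) = udiag G (fun=> 0).
      rewrite PE /udiag; have -> : rdiag (fun=> 0) = 0 :> 'M[C]_n.
        by apply/matrixP => a b; rewrite !mxE mul0rn.
      by rewrite mulmx0 mul0mx.
    have := udiag_inj i GG P0E; rewrite /indicator iA => /eqP.
    by rewrite oner_eq0.
  have P1 : udiag G (indicator p.2) != 1%:M.
    apply/eqP => PE; move: half; rewrite -GP PE.
    have -> : gns_sq U s 1%:M = 1.
      by apply: (@complexI R); rewrite -(gns_sqE DU) mul1mx trmxC1 mulmx1 trD.
    by rewrite leNgt invf_lt1 ?ltr1n.
  have := conductance_le Pp P0 P1; rewrite GP; apply: le_trans.
  rewrite ler_wpM2l ?(ltW conductance_gt0)// le_min lexx /=.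
  by move: half; lra.
have AV : h * V <= \sum_(p <- lv) p.1 * e (indicator p.2).
  have -> : V = \sum_(p <- lv) p.1 * \sum_i pi i * indicator p.2 i.
    under [RHS]eq_bigr => p _ do rewrite mulr_sumr.
    rewrite exchange_big; apply: eq_bigr => i _ /=; rewrite lv2 mulr_sumr.
    by apply: eq_bigr => p _; rewrite mulrCA.
  rewrite mulr_sumr !big_seq; apply: ler_sum => p plv.
  by rewrite mulrCA ler_wpM2l ?lv0// indV.
have opL0 : 0 <= opL by apply: le_trans (eigenvalue_le_norm k); exact: ltW.
(* The operator norm enters here: the degree of the vertex j is at most |L| times the squared KMS
   norm of a projection, itself at most its mass [pi j]. *)
have BV : \sum_j y j ^+ 2 * e (indicator [set j]%SET) <= opL * V.
  rewrite mulr_sumr; apply: ler_sum => j _.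
  have -> : opL * (pi j * y j ^+ 2) = y j ^+ 2 * (opL * pi j) by ring.
  rewrite ler_wpM2l ?sqr_ge0//; apply: le_trans (dirichlet_le_norm _) _.
  apply: ler_wpM2l opL0 _ _ _; rewrite piE; apply: (kms_sq_le_gns DU).
  exact: udiag_trmxC.
(* [X] has mean zero, so shifting by the median only increases its KMS norm. Since the Dirichlet
   form is unchanged by the shift, the quotient of [e y] by [V] is at most [lam k]. *)
have V0 : kms_sq D X <= V.
  rewrite /V -gnsE yE; apply: le_trans (kms_sq_le_gns DU _); last first.
    by rewrite trmxCB Xh trmxC_scalar conjC_real.
  have -> : X - (m%:C)%:M = X + ((- m)%:C)%:M.
    by rewrite rmorphN /= raddfN.
  by rewrite (kms_sq_shift DU trD _ X1) lerDl sqr_ge0.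
have eV : e y <= lam k * V.
  have -> : e y = lam k * kms_sq D X.
    rewrite /e yE dirichlet_shift LX kmsZr (kms_sqC DU) -rmorphM.
    by [].
  by rewrite ler_wpM2l ?(ltW lk0).
have Vgt0 : 0 < V by apply: lt_le_trans V0; exact: (kms_sq_gt0 DU smin_gt0 s_bounds).
have h0 := conductance_gt0.
have key : (smin * (h * V)) ^+ 2 <= smax ^+ 2 * (lam k * V * (2 * (opL * V))).
  apply: le_trans (le_trans main _).
    rewrite lerXn2r ?nnegrE ?mulr_ge0 ?(ltW smin_gt0) ?(ltW h0) ?(ltW Vgt0)//.
      by apply: le_trans AV; rewrite mulr_ge0 ?(ltW h0) ?(ltW Vgt0).
    by rewrite ler_wpM2l ?(ltW smin_gt0).
  rewrite ler_wpM2l ?sqr_ge0//; apply: ler_pM => //.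
  - exact: dirichlet_ge0.
  - rewrite mulr_ge0//; apply: sumr_ge0 => j _; rewrite mulr_ge0 ?sqr_ge0//.
    exact: dirichlet_ge0.
  - by rewrite ler_wpM2l.
rewrite -(ler_pM2r (exprn_gt0 2 Vgt0)); move: key.
by congr (_ <= _); ring.
Qed.

(** * Trace distance to the invariant state *)

Lemma mxtrace_udiag_bound (T G : 'M[C]_n) (x : 'I_n -> R) b : T^t* = T ->
  G *m G^t* = 1%:M -> (forall i, `|x i| <= b) ->
  `|complex.Re (\tr (T *m udiag G x))| <= trnorm T * b.
Proof.
move=> Th GG xb; have [z _ Tsp] := hermitian_spectral Th.
have VV := spectralmx_adjK T; move: (spectralmx T) VV Tsp => V VV TE.
have tn : trnorm T = \sum_i `|z i| by rewrite TE; exact: trnorm_conj_rdiag.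
rewrite tn mxtrace_mulC.
have -> : T = udiag V z by [].
rewrite Re_mxtrace_mul_udiag mulr_suml.
apply: le_trans (ler_norm_sum _ _ _) _; apply: ler_sum => i _.
rewrite normrM mulrC ler_wpM2l//; clear tn.
(* In the eigenbasis of [T], each diagonal entry of [udiag G x] is an average of the x k, with
   weights the squared moduli of a row of the unitary [M]. *)
pose M := V *m G^t*.
have ME : V *m udiag G x *m V^t* = M *m rdiag x *m M^t*.
  by rewrite /M trmxCM trmxCK /udiag !mulmxA.
have MM : M *m M^t* = 1%:M.
  by rewrite /M trmxCM trmxCK mulmxA -(mulmxA V) (mulmx1C GG) mulmx1.
clearbody M.
have -> : (V *m udiag G x *m V^t*) i i = (\sum_k x k * nsq (M i k))%:C.
  rewrite ME mxE rmorph_sum; apply: eq_bigr => k _ /=.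
  by rewrite mul_mx_rdiag !mxE mulrAC [M i k * _]mulrC -nsqE -rmorphM mulrC.
rewrite /=; apply: le_trans (ler_norm_sum _ _ _) _.
have M1 : \sum_k nsq (M i k) = 1.
  apply: (@complexI R); rewrite rmorph_sum rmorph1.
  have /matrixP/(_ i i) := MM; rewrite mxE [RHS]mxE eqxx => MMi.
  rewrite -[RHS]MMi; apply: eq_bigr => k _ /=.
  by rewrite nsqE !mxE mulrC.
rewrite -[leRHS]mulr1 -M1 mulr_sumr; apply: ler_sum => k _.
by rewrite normrM (ger0_norm (nsq_ge0 _)) ler_wpM2r ?nsq_ge0.
Qed.

(** With W the sign of T = D^(1/2) Y D^(1/2), the trace norm of T is the trace of W T, that is <W,
    Y>. Cauchy-Schwarz concludes, since W has square 1 and so KMS norm at most its GNS norm 1. *)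
Lemma trnorm_le_kms (Y : 'M[C]_n) : Y^t* = Y ->
  trnorm (mxsqrt D *m Y *m mxsqrt D) <= Num.sqrt (kms_sq D Y).
Proof.
move=> Yh; have Sh := mxsqrt_trmxC DU.
have Th : (mxsqrt D *m Y *m mxsqrt D)^t* = mxsqrt D *m Y *m mxsqrt D.
  by move: (mxsqrt D) Sh => S Sh; rewrite !trmxCM Sh Yh mulmxA.
have [z _ Tsp] := hermitian_spectral Th.
set T := mxsqrt D *m Y *m mxsqrt D in Th Tsp *.
have VV := spectralmx_adjK T; have VV' := spectralmxK T.
move: (spectralmx T) VV VV' Tsp => V VV VV' TE.
(* The sign of 0 is taken to be 1, so that [W] has square 1 even for singular T. *)
pose sg i : R := if z i < 0 then - 1 else 1.
have sgz i : sg i * z i = `|z i|.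
  by rewrite /sg; case: ltrP => zi; rewrite ?mulN1r ?mul1r ?(ltr0_norm zi) ?ger0_norm.
have sgsg : (fun i => sg i * sg i) = fun=> 1.
  by apply/funext => i; rewrite /sg; case: ifP; rewrite ?mulrNN mulr1.
pose W := udiag V sg.
have tn : trnorm T = \sum_i `|z i| by rewrite {1}TE; exact: trnorm_conj_rdiag.
have kW : kms D W Y = (trnorm T)%:C.
  have -> : kms D W Y = \tr (W *m T).
    by rewrite /kms /W udiag_trmxC /T; move: (mxsqrt D) => S; rewrite !mulmxA.
  rewrite tn {1}TE -/(udiag V z) (udiagM _ _ VV) (mxtrace_udiag _ VV).
  by congr (_%:C); apply: eq_bigr => i _; rewrite sgz.
have -> : trnorm T = complex.Re (kms D W Y) by rewrite kW.
apply: le_trans (kms_CauchySchwarz _ _) _.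
rewrite -[leRHS]mul1r ler_wpM2r ?sqrtr_ge0// -sqrtr1 ler_wsqrtr//.
apply: le_trans (kms_sq_le_gns DU (udiag_trmxC V sg)) _.
rewrite le_eqVlt; apply/orP; left; apply/eqP; apply: (@complexI R).
by rewrite -(gns_sqE DU) udiag_trmxC (udiagM _ _ VV) sgsg (udiag1 VV') mulmx1 trD.
Qed.

(** KMS symmetry intertwines the two pictures: the dual semigroup sends D^(1/2) Y D^(1/2) to D^(1/2)
    Phi_t(Y) D^(1/2). It is tested here on matrix units. *)
Lemma tr_adjoint_relative t (D' : 'M[C]_n) : 0 <= t ->
  tr_adjoint (Phi t) D' = mxsqrt D *m Phi t (relative U s D') *m mxsqrt D.
Proof.
move=> t0; apply/matrixP => i j.
have -> : tr_adjoint (Phi t) D' i j = \tr (D' *m Phi t (delta_mx j i)) by rewrite mxE.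
have := Phi_sym t0 (delta_mx i j) (relative U s D').
rewrite (kms_relative DU) -semigroup_trmxC// trmxC_delta mxtrace_mulC => <-.
rewrite /kms trmxC_delta -(mxtrace_delta_mul j i).
by move: (mxsqrt D) => S; rewrite !mulmxA.
Qed.

Lemma state_dist_relative t (D' : 'M[C]_n) : 0 <= t ->
  tr_adjoint (Phi t) D' - D =
  mxsqrt D *m Phi t (relative U s D' - 1%:M) *m mxsqrt D.
Proof.
move=> t0; rewrite tr_adjoint_relative// raddfB /= (qms_unital Phi_qms t0).
have := mxsqrtK D0; move: (mxsqrt D) => S SS.
by rewrite mulmxBr mulmxBl mulmx1 SS.
Qed.

Lemma relative_dist_trmxC t (D' : 'M[C]_n) : 0 <= t -> D'^t* = D' ->
  (Phi t (relative U s D' - 1%:M))^t* = Phi t (relative U s D' - 1%:M).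
Proof.
move=> t0 D'h; rewrite -semigroup_trmxC//; congr (Phi t _).
by rewrite trmxCB trmxC1 relative_trmxC.
Qed.

(** Z = D^(-1/2) D' D^(-1/2) - 1 has mean zero, so <Z, Z> = <Z + 1, Z + 1> - 1. This is at most
    1/smin - 1, because the trace of D'^2 is at most 1, and it decays under the semigroup. *)
Lemma state_dist_decay t a (D' : 'M[C]_n) : 0 <= t ->
  (forall k, lam k != 0 -> a <= t * lam k) -> density_matrix D' ->
  trnorm (tr_adjoint (Phi t) D' - D) <= expR (- a) * Num.sqrt (smin^-1 - 1).
Proof.
move=> t0 ta D'd; have [D'0 trD'] := D'd; have D'h := psdmx_hermitian D'0.
rewrite state_dist_relative//; set Z := relative U s D' - 1%:M.
apply: le_trans (trnorm_le_kms (relative_dist_trmxC t0 D'h)) _.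
have Z1 : kms D 1%:M Z = 0.
  rewrite /Z kmsBr (kms_relative DU) trmxC1 mul1mx trD' (kms_1l DU) /state mulmx1.
  by rewrite trD subrr.
rewrite -[expR _]ger0_norm ?expR_ge0// -sqrtr_sqr -sqrtrM ?sqr_ge0// ler_wsqrtr//.
apply: le_trans (kms_sq_decay t0 ta Z1) _; rewrite ler_wpM2l ?sqr_ge0//.
have := kms_sq_shift DU trD 1 Z1; rewrite expr1n /Z rmorph1 subrK => relE.
rewrite lerBrDr -relE; apply: le_trans (kms_sq_relative DU smin_gt0 s_bounds _) _.
by rewrite ler_piMr ?invr_ge0 ?(ltW smin_gt0)// hs2_density.
Qed.

(** The initial state is the rank-one projection on an eigenvector of X whose eigenvalue x i has
    largest modulus. As X has mean zero, the difference of states at time t pairs with X to e^(- t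
    lam k) x i, and this is at most its trace norm times |x i|. *)
Lemma eigenvalue_decay_le t eps k : 0 <= t -> lam k != 0 ->
  sup [set trnorm (tr_adjoint (Phi t) D' - D) | D' in [set D' | density_matrix D']]
    <= 2 * eps ->
  expR (- (t * lam k)) <= 2 * eps.
Proof.
move=> t0 lk supe.
have [X [X0 Xh LX]] := hermitian_eigenvector k.
have X1 : state D X = 0.
  rewrite -(kms_1l DU); have := kms_1_gen X; rewrite LX kmsZr => /eqP.
  rewrite mulf_eq0 => /orP[|/eqP//].
  by rewrite -(rmorph0 (real_complex R)) (inj_eq (@complexI _)) (negbTE lk).
have [x _ Xsp] := hermitian_spectral Xh.
have GG := spectralmx_adjK X; have GG' := spectralmxK X.
move: (spectralmx X) GG GG' Xsp => G GG GG' Xsp.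
have i0 : 'I_n by exact: Ordinal (ltnW n_ge2).
have [i _ imax] := @arg_maxP _ _ _ i0 xpredT (fun i => `|x i|) isT.
have xi0 : 0 < `|x i|.
  rewrite normr_gt0; apply/eqP => xi; case/negP: X0; rewrite Xsp.
  have -> : rdiag x = 0; last by rewrite mulmx0 mul0mx.
  apply/matrixP => a b; rewrite !mxE; have /= := imax a isT; rewrite xi normr0 normr_le0.
  by move=> /eqP ->; rewrite mul0rn.
pose D' : 'M[C]_n := udiag G (indicator [set i]%SET).
have ind0 j : 0 <= indicator [set i]%SET j :> R by rewrite /indicator ler0n.
have D'd : density_matrix D'.
  split; first exact: psd_conj_rdiag.
  rewrite mxtrace_udiag// (bigD1 i)//= big1 => [|j ji].
    by rewrite /indicator finset.in_set1 eqxx addr0.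
  by rewrite /indicator finset.in_set1 (negbTE ji).
have D'h := psdmx_hermitian D'd.1.
pose T := tr_adjoint (Phi t) D' - D.
have Th : T^t* = T.
  rewrite /T state_dist_relative//; have := relative_dist_trmxC t0 D'h.
  move: (Phi t _) (mxsqrt D) (mxsqrt_trmxC DU) => Y S Sh Yh.
  by rewrite !trmxCM Sh Yh mulmxA.
have T_le : trnorm T <= 2 * eps.
  (* The set under [sup] must be bounded; [state_dist_decay] with a = 0 bounds it uniformly. *)
  apply: le_trans supe; apply: ub_le_sup; last by exists D'.
  exists (expR (- 0) * Num.sqrt (smin^-1 - 1)) => _ [D'' D''d <-].
  by apply: state_dist_decay => // j _; rewrite mulr_ge0 ?eigenvalue_ge0.
have TX : complex.Re (\tr (T *m X)) = expR (- (t * lam k)) * x i.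
  have -> : \tr (T *m X) = (expR (- (t * lam k)))%:C * \tr (D' *m X).
    rewrite /T mulmxBl raddfB /= tr_adjointP -/(state D X) X1 subr0.
    by rewrite (semigroup_eigen Phi_L t0 LX) -scalemxAr mxtraceZ.
  have -> : \tr (D' *m X) = (x i)%:C.
    rewrite /D' {1}Xsp -/(udiag G x) (udiagM _ _ GG) (mxtrace_udiag _ GG); congr (_%:C).
    rewrite (bigD1 i)//= big1 => [|j ji].
      by rewrite /indicator finset.in_set1 eqxx mul1r addr0.
    by rewrite /indicator finset.in_set1 (negbTE ji) mul0r.
  by rewrite -rmorphM.
have := mxtrace_udiag_bound Th GG (fun j => imax j isT).
rewrite -/(udiag G x) in Xsp; rewrite -Xsp TX normrM (ger0_norm (expR_ge0 _)).
by rewrite ler_pM2r// => h1; exact: le_trans h1 T_le.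
Qed.

(** The n >= 2 eigenvalues sum to 1. Hence 1/smin - 1 >= 1, and the logarithm in the upper bound is
    nonnegative, as a time must be. *)
Lemma smin_le_half : smin <= 2^-1.
Proof.
have [UU UU' s0 _ DE] := DU.
have s1 : \sum_a s a ^+ 2 = 1.
  apply: (@complexI R); rewrite rmorph1 -trD DE.
  by rewrite -/(udiag U (fun i => s i ^+ 2)) mxtrace_udiag.
have : smin *+ n <= 1.
  rewrite -s1 -[n in leLHS]card_ord -sumr_const; apply: ler_sum => a _.
  by have [? _] := andP (s_bounds a).
have : smin *+ 2 <= smin *+ n by rewrite ler_pMn2l.
by move=> h1 h2; have := le_trans h1 h2; lra.
Qed.

(** * The two bounds on the mixing time *)

Lemma mixing_time_ge eps : 0 < eps -> eps < 1 / 2 ->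
  ((Num.sqrt (smax * smin) / (smin + smax) * (1 / h) * ln (1 / (2 * eps)))%:E
    <= mixing_time D Phi eps)%E.
Proof.
move=> e0 e1; apply: le_ereal_inf_tmp => _ [t [t0 supe] <-]; rewrite lee_fin.
have [k k0 kmin] := spectral_gap.
have h0 := conductance_gt0; have hk := conductance_ge (ltW k0) kmin.
have e20 : 0 < 2 * eps by rewrite mulr_gt0.
have kt : ln (1 / (2 * eps)) <= t * lam k.
  have := eigenvalue_decay_le t0 (lt0r_neq0 k0) supe.
  rewrite -{1}[2 * eps]lnK ?posrE// ler_expR div1r lnV ?posrE//; lra.
have l0 : 0 <= ln (1 / (2 * eps)).
  by rewrite ln_ge0// ler_pdivlMr// mul1r; lra.
set c := Num.sqrt _ / _ in hk *.
(* [hk] reads c / h <= 1 / lam k, so the relaxation time separates the two sides. *)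
apply: le_trans (_ : _ <= (lam k)^-1 * ln (1 / (2 * eps))) _.
  rewrite ler_wpM2r// div1r ler_pdivrMr// mulrC ler_pdivlMr//.
  by rewrite mulrC.
by rewrite mulrC ler_pdivrMr.
Qed.

Lemma mixing_time_le eps : 0 < eps -> eps < 1 / 2 ->
  (mixing_time D Phi eps <=
   ((2 * smax ^+ 2 * opL) / (smin ^+ 2 * h ^+ 2)
     * ln (Num.sqrt (smin^-1 - 1) / (2 * eps)))%:E)%E.
Proof.
move=> e0 e1; set K := _ / (smin ^+ 2 * h ^+ 2).
set r := Num.sqrt (smin^-1 - 1); set a := ln (r / (2 * eps)).
have h0 := conductance_gt0; have e20 : 0 < 2 * eps by rewrite mulr_gt0.
have [k0 lk0 _] := spectral_gap.
have opL0 : 0 <= opL by apply: le_trans (eigenvalue_le_norm k0); exact: ltW.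
have hs0 : 0 < smin ^+ 2 * h ^+ 2 by rewrite mulr_gt0 ?exprn_gt0.
have K0 : 0 <= K.
  apply: divr_ge0 (ltW hs0); apply: mulr_ge0 opL0.
  by rewrite pmulr_rge0 ?sqr_ge0.
have r1 : 1 <= r.
  rewrite -sqrtr1 ler_wsqrtr// lerBrDr -[X in X <= _]invrK.
  rewrite lef_pV2 ?posrE ?invr_gt0//.
  exact: smin_le_half.
have a0 : 0 <= a.
  by rewrite /a ln_ge0// ler_pdivlMr// mul1r; move: r1; lra.
(* The Cheeger bound says K lam k >= 1, so at time K a every nonconstant mode is damped by at least
   e^(- a). *)
have Ka k : lam k != 0 -> a <= K * a * lam k.
  move=> lk; rewrite mulrAC ler_peMl// /K mulrAC ler_pdivlMr// mul1r.
  exact: cheeger_bound.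
have r0 : 0 < r by apply: lt_le_trans r1.
apply: ereal_inf_lbound; exists (K * a) => //; split; first exact: mulr_ge0.
apply: sup_le_ub; first by exists (trnorm (tr_adjoint (Phi (K * a)) D - D)); exists D.
move=> _ [D' D'd <-]; have := state_dist_decay (mulr_ge0 K0 a0) Ka D'd.
move=> /le_trans; apply; rewrite -/r /a expRN lnK ?posrE ?divr_gt0//.
by rewrite invf_div divfK ?gt_eqF.
Qed.

End EigenExpansion.

(** [eigenvalue] refers to row eigenvectors; the adjoint of one yields the Rayleigh quotient through
    which positive definiteness gives smin > 0. *)
Lemma eigenvalue_quad {R : realType} n (A : 'M[R[i]]_n) (a : R[i]) : eigenvalue A a ->
  exists2 v : 'cV[R[i]]_n, v != 0 & (v^t* *m A *m v) 0 0 = a * (hs2 v)%:C.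
Proof.
move=> /eigenvalueP[u uA u0]; exists (u^t*).
  by apply: contra u0 => /eqP u0; rewrite -(trmxCK u) u0 trmx0 map_mx0.
by rewrite trmxCK uA -scalemxAl mxE -hs2E trmxCK /mxtrace big_ord1.
Qed.

Lemma frame_eigenvalue {R : realType} n (D U : 'M[R[i]]_n) s i : kms_frame D U s ->
  eigenvalue D (s i ^+ 2)%:C.
Proof.
move=> [UU UU' _ _ DE]; apply/eigenvalueP; exists (row i U).
  rewrite {1}DE -row_mul !mulmxA UU mul1mx; apply/rowP => j.
  by rewrite mxE mul_rdiag_mx !mxE.
apply/eqP => u0; have /matrixP/(_ i i)/eqP := UU.
rewrite mxE big1 ?mxE ?eqxx ?(eq_sym 0) ?oner_eq0// => j _.
by have /rowP/(_ j) := u0; rewrite !mxE => ->; rewrite mul0r.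
Qed.

Local Open Scope classical_set_scope.
Local Open Scope ring_scope.
Local Open Scope complex_scope.

Theorem theorem3p7 (R : realType) (n : nat) (n_ge2 : (2 <= n)%N)
  (Phi : R -> {linear 'M[R[i]]_n -> 'M[R[i]]_n})
  (L : {linear 'M[R[i]]_n -> 'M[R[i]]_n})
  (Phi_qms : quantum_markov_semigroup Phi)
  (Phi_L : is_generator Phi L)
  (Phi_primitive : primitive Phi L)
  (D : 'M[R[i]]_n)
  (D_faithful : faithful_density D)
  (D_invariant : invariant_density D Phi)
  (Phi_sym : kms_symmetric D Phi)
  (smin smax : R)
  (sminP : is_min_eigenvalue D smin)
  (smaxP : is_max_eigenvalue D smax)
  (eps : R) (eps_gt0 : 0 < eps) (eps_lt : eps < 1 / 2) :
  ((Num.sqrt (smax * smin) / (smin + smax) * (1 / conductance D L)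
      * ln (1 / (2 * eps)))%:E
    <= mixing_time D Phi eps)%E /\
  (mixing_time D Phi eps
    <= ((2 * smax ^+ 2 * map_norm (kms_norm D) L)
          / (smin ^+ 2 * conductance D L ^+ 2)
        * ln (Num.sqrt (smin^-1 - 1) / (2 * eps)))%:E)%E.
Proof.
have [Dpd trD] := D_faithful.
have [U [s DU]] := kms_frame_exists Dpd.
have D0 := frame_psd DU.
have s_bounds a : smin <= s a ^+ 2 <= smax.
  have ea := frame_eigenvalue a DU.
  by rewrite -!lecR (sminP.2 _ ea) (smaxP.2 _ ea).
have smin_gt0 : 0 < smin.
  have [v v0 vE] := eigenvalue_quad sminP.1.
  have := Dpd v v0; rewrite vE -rmorphM ltcR pmulr_lgt0//.
  by rewrite lt_neqAle hs2_ge0 eq_sym hs2_eq0 v0.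
have kerL := Phi_primitive.2.
have Lsym := generator_kms_symmetric Phi_L D0 Phi_sym.
have [lam [E [LE Eorth Ecomplete]]] := kms_spectral DU Lsym.
split.
  exact: (mixing_time_ge DU trD smin_gt0 s_bounds Phi_qms Phi_L Phi_sym kerL
    LE Eorth Ecomplete n_ge2 eps_gt0 eps_lt).
exact: (mixing_time_le DU trD smin_gt0 s_bounds Phi_qms Phi_L Phi_sym kerL
  LE Eorth Ecomplete n_ge2 eps_gt0 eps_lt).
Qed.
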